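(* Let $d\ge1$, $\gamma\in(0,1)$ and $\gamma'=1/(1-\gamma)$. For any finite non-zero measure $\mu$ on $\mathbb{R}^d$, the equation $$v(t,x)=(S_t\mu)(x)+\int_0^t (S_{t-s}v^\gamma(s,\cdot))(x)\,ds,\quad x\in\mathbb{R}^d,\ t>0,$$ has a unique solution $v(t,x)=v(t,x,\mu)$ such that $$v(\cdot,\cdot,\mu)\in L^\infty_{loc}\big((0,\infty),L^{1,w}_+(\mathbb{R}^d)\big)\cap C^+\big((0,\infty)\times\mathbb{R}^d\big)$$ and $$\big((1-\gamma)t\big)^{\gamma'}<v(t,x,\mu)\le e^t(S_t\mu)(x)+e^t,\quad 0<t<\infty,\ x\in\mathbb{R}^d.$$ Moreover, this solution depends continuously on the initial data: if a sequence $\{\mu_n\}_{n\ge1}$ of finite non-zero measures on $\mathbb{R}^d$ converges weakly to a finite non-zero measure $\mu$, then $$\lim_{n\to\infty}v(t,x,\mu_n)=v(t,x,\mu)\quad\text{for any }(t,x)\in(0,\infty)\times\mathbb{R}^d.$$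
   Context: $p_t(x)=(2\pi t)^{-d/2}e^{-|x|^2/(2t)}$ is the Brownian transition density on $\mathbb{R}^d$; $S_tf(x)=\int p_t(x-y)f(y)\,dy$ for functions $f$ and $S_t\mu(x)=\int p_t(x-y)\,\mu(dy)$ for measures $\mu$. $w(x)=C_we^{-|x|}$ with $\int_{\mathbb{R}^d}w\,dx=1$. $L^{1,w}(\mathbb{R}^d)$ is the space of (classes of) measurable $f$ with $\|f\|_{1,w}=\int|w(x)f(x)|\,dx<\infty$; the subscript $+$ denotes nonnegative elements. $L^\infty_{loc}((0,\infty),L^{1,w}_+(\mathbb{R}^d))$ is the set of measurable functions $f$ on $(0,\infty)\times\mathbb{R}^d$ with $f(t,\cdot)\in L^{1,w}_+(\mathbb{R}^d)$ for each $t$ and $t\mapsto\|f(t)\|_{1,w}\in L^\infty([a,b])$ for every compact interval $[a,b]\subset(0,\infty)$. $C^+((0,\infty)\times\mathbb{R}^d)$ denotes the nonnegative continuous functions on $(0,\infty)\times\mathbb{R}^d$. *)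

(* Defs.v *)
From HB Require Import structures.
From mathcomp Require Import all_boot all_order all_algebra.
From mathcomp Require Import all_classical all_reals all_analysis.
From mathcomp Require Import measurable_realfun.

Set Implicit Arguments.
Unset Strict Implicit.
Unset Printing Implicit Defensive.

Import Order.TTheory GRing.Theory Num.Theory.
Import numFieldNormedType.Exports.

Local Open Scope classical_set_scope.
Local Open Scope ring_scope.

(* R^d is the type 'rV[R]_d, with its Borel sigma-algebra. *)
HB.instance Definition _ (R : realType) (d : nat) :=
  Measurable.copy 'rV[R]_d (g_sigma_algebraType (@open 'rV[R]_d)).

Section borel_rV.
Context {R : realType}.

Lemma measurable_rV_coord d (i : 'I_d) :
  measurable_fun [set: 'rV[R]_d] (fun x : 'rV[R]_d => x ord0 i).
Proof.
apply: (measurability (@RGenOpens.G R)).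
  exact: RGenOpens.measurableE.
move=> _ [A [a [b ->]] <-]; rewrite setTI; apply: sub_sigma_algebra.
apply: open_comp; last exact: interval_open.
by move=> x _; exact: coord_continuous.
Qed.

Lemma measurable_fun_rV disp (T : measurableType disp) d (f : T -> 'rV[R]_d) :
  (forall i, measurable_fun [set: T] (fun x => f x ord0 i)) ->
  measurable_fun [set: T] f.
Proof.
move=> mf; apply: (measurability (@open 'rV[R]_d)) => //.
move=> _ [U oU <-]; rewrite setTI.
pose c (q : 'rV[rat]_d) : 'rV[R]_d := \row_i ratr (q ord0 i).
pose r (n : nat) : R := n.+1%:R^-1.
have r0 n : 0 < r n by rewrite invr_gt0.
pose box (q : 'rV[rat]_d) n : set T :=
  \bigcap_i ((fun x => f x ord0 i) @^-1` ball (c q ord0 i) (r n)).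
have boxE q n x : box q n x <-> ball (c q) (r n) (f x).
  split.
    by move=> h; split=> // i j; rewrite ord1; exact: h.
  by move=> [_ h] i _; exact: h.
have mbox q n : measurable (box q n).
  apply: fin_bigcap_measurable; first exact: finite_finset.
  move=> i _; rewrite -[X in measurable X]setTI; apply: mf => //.
  exact: measurable_ball.
have -> : f @^-1` U = \bigcup_(p : 'rV[rat]_d * nat)
    (if `[< ball (c p.1) (r p.2) `<=` U >] then box p.1 p.2 else set0).
  apply/seteqP; split=> [x Ux|x [[q n] _] /=].
    have /nbhs_ballP[e /= e0 eU] : nbhs (f x) U by apply: open_nbhs_nbhs; split.
    have [n _ /(_ n (leqnn n)) ne] : \forall n \near \oo, r n < e / 2.
      by apply: near_infty_natSinv_lt (PosNum (divr_gt0 e0 (ltr0n _ 2))).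
    have hq i : exists q : rat, ratr q \in `]f x ord0 i - r n, f x ord0 i + r n[.
      apply: rat_in_itvoo; rewrite ltrD2l; by apply: lt_trans (r0 n); rewrite oppr_lt0.
    pose q : 'rV[rat]_d := \row_i projT1 (cid (hq i)).
    have cqx : ball (c q) (r n) (f x).
      split=> // i j; rewrite ord1 /c !mxE; case: cid => y /=.
      rewrite in_itv /= => yfx; rewrite /ball /=.
      by rewrite ltr_distl.
    exists (q, n) => //=; case: asboolP => [_|]; first exact/boxE.
    case=> y cqy; apply: eU.
    rewrite (splitr e); apply: (@ball_triangle _ _ (c q)).
      by apply: ball_sym; apply: le_ball cqx; exact: ltW.
    by apply: le_ball cqy; exact: ltW.
  by case: asboolP => // qU /boxE; exact: qU.
apply: countable_bigcupT_measurable; first exact: countableP.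
by move=> p; case: ifP.
Qed.

Definition rV_cons d (p : R * 'rV[R]_d) : 'rV[R]_d.+1 :=
  \row_i (if unlift ord0 i is Some j then p.2 ord0 j else p.1).

Definition rV_uncons d (x : 'rV[R]_d.+1) : R * 'rV[R]_d :=
  (x ord0 ord0, \row_j x ord0 (lift ord0 j)).

Lemma rV_unconsK d : cancel (@rV_uncons d) (@rV_cons d).
Proof.
by move=> x; apply/rowP => i; rewrite mxE; case: unliftP => [j|] ->//=; rewrite mxE.
Qed.

Lemma rV_consK d : cancel (@rV_cons d) (@rV_uncons d).
Proof.
move=> [a x]; rewrite /rV_uncons !mxE unlift_none /=; congr pair.
by apply/rowP => i; rewrite !mxE liftK.
Qed.

Lemma measurable_rV_cons d : measurable_fun [set: R * 'rV[R]_d] (@rV_cons d).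
Proof.
apply: measurable_fun_rV => i; case: (unliftP ord0 i) => [j|] ->.
  under eq_fun do rewrite mxE liftK.
  exact: measurableT_comp (measurable_rV_coord j) measurable_snd.
under eq_fun do rewrite mxE unlift_none.
exact: measurable_fst.
Qed.

Lemma measurable_rV_uncons d :
  measurable_fun [set: 'rV[R]_d.+1] (@rV_uncons d).
Proof.
apply: measurable_fun_pair; first exact: measurable_rV_coord.
apply: measurable_fun_rV => i; under eq_fun do rewrite mxE.
exact: measurable_rV_coord.
Qed.

End borel_rV.

Section lebesgue_rV.
Context {R : realType}.

Section step.
Context (d : nat) (mu : {sigma_finite_measure set 'rV[R]_d -> \bar R}).

Let prod : {measure set (measurableTypeR R * 'rV[R]_d)%type -> \bar R} :=
  (@lebesgue_measure R \x mu)%E.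

Definition lebesgue_rV_step : set 'rV[R]_d.+1 -> \bar R :=
  pushforward prod (@rV_cons R d).

Let mcons : measurable_fun [set: (measurableTypeR R * 'rV[R]_d)%type] (@rV_cons R d).
Proof. exact: measurable_rV_cons. Qed.

HB.instance Definition _ := Measure.copy lebesgue_rV_step
  (measure_function_pushforward__canonical__measure_function_Measure prod mcons).

Let sigma_finite_step : sigma_finite setT lebesgue_rV_step.
Proof.
have /sigma_finiteP[F [FT ndF Foo]] := sigma_finiteT (@lebesgue_measure R).
have /sigma_finiteP[G [GT ndG Goo]] := sigma_finiteT mu.
exists (fun n => @rV_uncons R d @^-1` (F n `*` G n)).
  apply/seteqP; split=> // x _.
  have [k _ Fk] : (\bigcup_i F i) (rV_uncons x).1 by rewrite -FT.
  have [n _ Gn] : (\bigcup_i G i) (rV_uncons x).2 by rewrite -GT.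
  exists (maxn k n) => //; split.
    by apply: (subsetPset _ _ (ndF _ _ (leq_maxl k n))).
  by apply: (subsetPset _ _ (ndG _ _ (leq_maxr k n))).
move=> n; have [mF Fn] := Foo n; have [mG Gn] := Goo n; split.
  rewrite -[X in measurable X]setTI; apply: measurable_rV_uncons => //.
  exact: measurableX.
rewrite /lebesgue_rV_step /pushforward -comp_preimage.
have -> : @rV_uncons R d \o @rV_cons R d = id.
  by apply/funext => y; exact: rV_consK.
by rewrite /= product_measure1E// lte_mul_pinfty// ge0_fin_numE.
Qed.

HB.instance Definition _ := Measure_isSigmaFinite.Build _ _ _
  lebesgue_rV_step sigma_finite_step.

End step.

(* R^0 is a point, and R^(d+1) is identified with R x R^d through rV_cons. *)
Fixpoint lebesgue_rV (d : nat) : {sigma_finite_measure set 'rV[R]_d -> \bar R} :=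
  if d is d'.+1 then lebesgue_rV_step (lebesgue_rV d') else \d_(0 : 'rV[R]_0).

Lemma lebesgue_rV_prod d (A : 'I_d -> set R) : (forall i, measurable (A i)) ->
  lebesgue_rV d [set x : 'rV[R]_d | forall i, A i (x ord0 i)] =
  (\prod_(i < d) lebesgue_measure (A i))%E.
Proof.
elim: d A => [|d IH] A mA.
  rewrite big_ord0 /= diracE mem_set//.
  by case.
rewrite big_ord_recl -IH//= /lebesgue_rV_step /pushforward.
pose B := [set x : 'rV[R]_d | forall i, A (lift ord0 i) (x ord0 i)].
have mB : measurable B.
  rewrite [B](_ : _ =
    \bigcap_i ((fun x : 'rV[R]_d => x ord0 i) @^-1` A (lift ord0 i))).
    apply: fin_bigcap_measurable; first exact: finite_finset.
    by move=> i _; rewrite -[X in measurable X]setTI; exact: measurable_rV_coord.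
  by apply/seteqP; split=> x h i; [move=> _|]; exact: h.
transitivity (product_measure1 (@lebesgue_measure R) (lebesgue_rV d) (A ord0 `*` B));
  last exact: (@product_measure1E _ _ _ _ R (@lebesgue_measure R) (lebesgue_rV d) _ _ (mA ord0) mB).
suff -> : A ord0 `*` B =
  @rV_cons R d @^-1` [set x : 'rV[R]_d.+1 | forall i, A i (x ord0 i)] by [].
apply/seteqP; split=> -[a x] /=; last first.
  move=> h; split=> [|i].
    by have := h ord0; rewrite mxE unlift_none.
  by have := h (lift ord0 i); rewrite mxE liftK.
by move=> [h0 h] i; rewrite mxE; case: unliftP => [j|] ->.
Qed.

End lebesgue_rV.

Section heat_semigroup.
Context {R : realType} {d : nat}.
Implicit Types (t : R) (x y : 'rV[R]_d).

(* The norm of the library on 'rV[R]_d is the sup norm. *)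
Definition enorm x : R := Num.sqrt (\sum_(i < d) (x ord0 i) ^+ 2).

Definition heat_kernel t x : R :=
  (2 * pi * t) `^ (- (d%:R / 2)) * expR (- (enorm x ^+ 2 / (2 * t))).

Definition heat_fun t (f : 'rV[R]_d -> R) x : \bar R :=
  (\int[lebesgue_rV d]_y (heat_kernel t (x - y) * f y)%:E)%E.

Definition heat_measure t (mu : set 'rV[R]_d -> \bar R) x : \bar R :=
  (\int[mu]_y (heat_kernel t (x - y))%:E)%E.

End heat_semigroup.

Section function_spaces.
Context {R : realType} {d : nat}.
Implicit Types (w : 'rV[R]_d -> R) (v : R -> 'rV[R]_d -> R).

(* Cw is fixed in the theorem by the requirement that the weight has
   integral 1. *)
Definition weight (Cw : R) (x : 'rV[R]_d) : R := Cw * expR (- enorm x).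

Definition norm1w w (f : 'rV[R]_d -> R) : \bar R :=
  (\int[lebesgue_rV d]_x `|w x * f x|%:E)%E.

Definition L1w_nonneg w (f : 'rV[R]_d -> R) : Prop :=
  [/\ measurable_fun setT f,
      {ae lebesgue_rV d, forall x, 0 <= f x} &
      (norm1w w f < +oo)%E].

Definition space_time : set (R * 'rV[R]_d) := [set p | 0 < p.1].

(* The L^infinity norm over [a, b] is that of the extension by 0. *)
Definition Linfty_loc_L1w w v : Prop :=
  [/\ measurable_fun space_time (fun p => v p.1 p.2),
      (forall t, 0 < t -> L1w_nonneg w (v t)) &
      forall a b : R, 0 < a -> a <= b ->
        measurable_fun `[a, b] (fun t : R => norm1w w (v t)) /\
        ('N[@lebesgue_measure R]_+oo
           [(fun t => norm1w w (v t)) \_ `[a, b]] < +oo)%E].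

Definition nonneg_continuous v : Prop :=
  {within space_time, continuous (fun p => v p.1 p.2)} /\
  forall t x, 0 < t -> 0 <= v t x.

End function_spaces.

Section equation.
Context {R : realType} {d : nat}.
Implicit Types (gamma Cw : R) (mu : set 'rV[R]_d -> \bar R)
  (v : R -> 'rV[R]_d -> R).

(* Equality in \bar R: both terms on the right are required to be finite. *)
Definition mild_solution gamma mu v : Prop :=
  forall t x, 0 < t ->
    ((v t x)%:E = heat_measure t mu x +
       \int[@lebesgue_measure R]_(s in `]0%R, t[)
         heat_fun (t - s) (fun y => v s y `^ gamma)%R x)%E.

Definition solution_bounds gamma mu v : Prop :=
  forall t x, 0 < t ->
    ((1 - gamma) * t) `^ (1 - gamma)^-1 < v t x /\
    ((v t x)%:E <= (expR t)%:E * heat_measure t mu x + (expR t)%:E)%E.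

(* Functions on (0, oo) x R^d are represented by total functions, whose values
   for t <= 0 are irrelevant. *)
Definition admissible_solution gamma Cw mu v : Prop :=
  [/\ mild_solution gamma mu v,
      Linfty_loc_L1w (weight Cw) v,
      nonneg_continuous v &
      solution_bounds gamma mu v].

Definition weak_cvg (mu_ : nat -> set 'rV[R]_d -> \bar R) mu : Prop :=
  forall phi : 'rV[R]_d -> R, continuous phi -> bounded_fun phi ->
    ((\int[mu_ n]_x (phi x)%:E)%E @[n --> \oo] --> (\int[mu]_x (phi x)%:E)%E).

End equation.

(* Main.v *)
Require Import Defs.
From mathcomp Require Import all_boot all_order all_algebra.
From mathcomp Require Import all_classical all_reals all_analysis.
From mathcomp Require Import measurable_realfun ess_sup_inf ring lra.
Set Implicit Arguments.
Unset Strict Implicit.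
Unset Printing Implicit Defensive.
Import Order.TTheory GRing.Theory Num.Theory.
Import numFieldNormedType.Exports.
Local Open Scope classical_set_scope.
Local Open Scope ring_scope.

(** For y' = y^gamma with y(0) = a, write Phi(t, a) for the solution
((1-gamma) t + a^(1-gamma))^(1/(1-gamma)), so that Phi(t, 0) is the lower bound of
the theorem. The semigroup property and Jensen's inequality show that, for a
solution v and fixed (t, x), the function s |-> S_{t-s} v(s, .)(x) is a subsolution
of this scalar equation with initial value S_t mu(x); hence
  v(t, x) <= Phi(t, S_t mu(x)) <= C max(S_t mu(x), Phi(t, 0)) <= C v(t, x)
with C = 2^(1/(1-gamma)). The same bound holds for the iterates of the mild
equation started at Phi(., 0), which increase to a solution.

Uniqueness and stability come from sublinearity: if a_n and b_n solve the
equation with data whose heat extensions are asymptotically equal, and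
(a_n - l b_n)^+ -> 0 pointwise, then a_n^gamma <= l^gamma b_n^gamma + o(1) and the
mild equation gives (a_n - l^gamma b_n)^+ -> 0. Starting from l = C, for which the
two-sided bound above gives the hypothesis, and iterating l |-> l^gamma, the
factor tends to 1, so (a_n - b_n)^+ -> 0. *)

(** * The heat kernel *)

(** Homogeneity replaces it: a factor l in front of a bound becomes l^gamma after one passage
    through the mild equation, and the iterated exponents gamma^n tend to 0. The comparison with the
    scalar equation and the stability argument both follow a multiplicative constant that shrinks to
    1, instead of an additive error. The other obstacle is time 0, where S_s mu may blow up like
    s^(-d/2): the resulting pointwise bound on v(s, .)^gamma, of order s^(-d gamma/2), need not be
    integrable in time. Dominated convergence in the time integral rests instead on S_{t-s} v(s,
    .)(x), which the mild equation bounds by v(t, x) for every s < t. For the same reason the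
    invariant of the iterates V_n is stated for S_{t-s} V_n(s, .), not for V_n. *)

Section kernel_algebra.
Context {R : realType}.
Implicit Types (s t : R).

Lemma enorm_sqr d (x : 'rV[R]_d) : enorm x ^+ 2 = \sum_(i < d) (x ord0 i) ^+ 2.
Proof. by rewrite /enorm sqr_sqrtr// sumr_ge0// => i _; exact: sqr_ge0. Qed.

Lemma enormN d (x : 'rV[R]_d) : enorm (- x) = enorm x.
Proof. by rewrite /enorm; under eq_bigr do rewrite mxE sqrrN. Qed.

Lemma heat_kernelN d t (x : 'rV[R]_d) : heat_kernel t (- x) = heat_kernel t x.
Proof. by rewrite /heat_kernel enormN. Qed.

Lemma heat_kernelC d t (x y : 'rV[R]_d) :
  heat_kernel t (x - y) = heat_kernel t (y - x).
Proof. by rewrite -heat_kernelN opprB. Qed.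

Lemma heat_kernel_ge0 d t (x : 'rV[R]_d) : 0 <= heat_kernel t x.
Proof. by rewrite mulr_ge0 ?powR_ge0 ?expR_ge0. Qed.

Lemma heat_kernel_gt0 d t (x : 'rV[R]_d) : 0 < t -> 0 < heat_kernel t x.
Proof. by move=> t0; rewrite mulr_gt0 ?expR_gt0// powR_gt0// !mulr_gt0 ?pi_gt0. Qed.

Lemma heat_kernel_le d t (x : 'rV[R]_d) : 0 < t ->
  heat_kernel t x <= (2 * pi * t) `^ (- (d%:R / 2)).
Proof.
move=> t0; rewrite ler_piMr ?powR_ge0// -[leRHS]expR0 ler_expR oppr_le0.
by rewrite divr_ge0 ?sqr_ge0// mulr_ge0 ?ltW.
Qed.

Lemma normal_pdf_sqrtE t (a b : R) : 0 < t ->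
  normal_pdf a (Num.sqrt t) b =
    (Num.sqrt (2 * pi * t))^-1 * expR (- ((b - a) ^+ 2 / (2 * t))).
Proof.
move=> t0; rewrite normal_pdfE; last by rewrite gt_eqF ?sqrtr_gt0.
rewrite /normal_peak /normal_fun sqr_sqrtr ?ltW// mulNr.
have -> : t * pi *+ 2 = 2 * pi * t by ring.
by have -> : t *+ 2 = 2 * t by ring.
Qed.

(** The kernel factorises over coordinates, with a normal density of variance t in the first one;
    integrals over R^d are thereby computed by induction on d from integrals of normal densities on
    R. *)
Lemma heat_kernel_rV_cons d t (a b : R) (x y : 'rV[R]_d) : 0 < t ->
  heat_kernel t (rV_cons (a, x) - rV_cons (b, y)) =
  normal_pdf a (Num.sqrt t) b * heat_kernel t (x - y).
Proof.
move=> t0; rewrite normal_pdf_sqrtE// /heat_kernel !enorm_sqr big_ord_recl.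
rewrite !mxE unlift_none /=.
have -> : \sum_(i < d) ((rV_cons (a, x) - rV_cons (b, y)) ord0 (lift ord0 i)) ^+ 2
    = \sum_(i < d) ((x - y) ord0 i) ^+ 2.
  by apply: eq_bigr => i _; rewrite !mxE liftK.
set S := \sum_(_ < _) _.
have -> : - (((a - b) ^+ 2 + S) / (2 * t)) =
    - ((b - a) ^+ 2 / (2 * t)) - S / (2 * t) by field; exact: lt0r_neq0.
rewrite expRD.
have p0 : 0 < 2 * pi * t by rewrite !mulr_gt0 ?pi_gt0.
have -> : (2 * pi * t) `^ (- (d.+1%:R / 2)) =
  (Num.sqrt (2 * pi * t))^-1 * (2 * pi * t) `^ (- (d%:R / 2)).
  rewrite -powR12_sqrt ?ltW// -powRN -powRD; last by apply/implyP => _; rewrite gt_eqF.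
  by congr (_ `^ _); rewrite -natr1; field.
by ring.
Qed.

(** Completing the square in y: the product of two Gaussians is a Gaussian in y times a factor free
    of y. This is the one-dimensional core of [chapman_kolmogorov]. *)
Lemma normal_pdf_prod s t (x y z : R) : 0 < s -> 0 < t ->
  normal_pdf x (Num.sqrt s) y * normal_pdf z (Num.sqrt t) y =
  normal_pdf x (Num.sqrt (s + t)) z *
  normal_pdf ((t * x + s * z) / (s + t)) (Num.sqrt (s * t / (s + t))) y.
Proof.
move=> s0 t0; have st0 : 0 < s + t by rewrite addr_gt0.
rewrite !normal_pdf_sqrtE// ?divr_gt0 ?mulr_gt0//.
rewrite mulrACA [RHS]mulrACA -!expRD -!invfM -!sqrtrM ?mulr_ge0 ?pi_ge0 ?ltW//.
congr (_ * expR _).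
  congr (Num.sqrt _)^-1; field; exact: lt0r_neq0.
by field; rewrite !lt0r_neq0.
Qed.

End kernel_algebra.

Section lebesgue_integral_rV.
Context {R : realType}.
Implicit Types (s t : R).

Lemma integral_lebesgue_rVS d (f : 'rV[R]_d.+1 -> \bar R) :
  measurable_fun setT f -> (forall x, 0 <= f x)%E ->
  (\int[lebesgue_rV d.+1]_x f x =
   \int[@lebesgue_measure R]_a \int[lebesgue_rV d]_x f (rV_cons (a, x)))%E.
Proof.
move=> mf f0.
have mcons : measurable_fun [set: (measurableTypeR R * 'rV[R]_d)%type]
    (@rV_cons R d) by exact: measurable_rV_cons.
transitivity (\int[pushforward (@lebesgue_measure R \x lebesgue_rV d)%E
   (@rV_cons R d)]_x f x)%E; first exact: eq_measure_integral.
rewrite ge0_integral_pushforward// preimage_setT.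
apply: (@fubini_tonelli1 _ _ _ _ R (@lebesgue_measure R) (lebesgue_rV d)
  (f \o @rV_cons R d)) => [|x]; last exact: f0.
exact: measurableT_comp.
Qed.

End lebesgue_integral_rV.

Lemma measurable_fun_pair_in d d1 d2 (T : measurableType d)
    (T1 : measurableType d1) (T2 : measurableType d2) (D : set T)
    (f : T -> T1) (g : T -> T2) : measurable D ->
  measurable_fun D f -> measurable_fun D g ->
  measurable_fun D (fun x => (f x, g x)).
Proof.
move=> mD mf mg.
apply: (eq_measurable_fun (fun x => ((f \_ D) x, (g \_ D) x))).
  by move=> x xD; rewrite !patchE xD.
by apply: measurable_funTS; apply: measurable_fun_pair; apply/(measurable_restrictT _ mD).
Qed.

Section kernel_measurable.
Context {R : realType} {d : nat}.

Lemma measurable_space_time : measurable (@space_time R d).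
Proof.
rewrite (_ : space_time = fst @^-1` `]0, +oo[%classic).
  by rewrite -[X in measurable X]setTI; exact: measurable_fst.
by apply/seteqP; split=> p /=; rewrite in_itv/= andbT.
Qed.

Lemma measurable_heat_kernel :
  measurable_fun (@space_time R d) (fun p => heat_kernel p.1 p.2).
Proof.
(* [G] writes the division by 2t as a power with exponent -1: the power function is measurable on
   all of R, and the two expressions agree for t > 0. *)
pose G (p : R * 'rV[R]_d) := (2 * pi * p.1) `^ (- (d%:R / 2)) *
  expR (- ((\sum_(i < d) (p.2 ord0 i) ^+ 2) * (2 * p.1) `^ (-1))).
have mG : measurable_fun setT G.
  apply: measurable_funM.
    apply: measurableT_comp (@measurable_powR R _) _.
    by apply: measurable_funM => //; exact: measurable_fst.
  apply: measurableT_comp (@measurable_expR R) _.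
  apply: measurable_funN; apply: measurable_funM.
    apply: measurable_sum => i; apply: measurable_funX.
    exact: measurableT_comp (measurable_rV_coord i) measurable_snd.
  apply: measurableT_comp (@measurable_powR R _) _.
  by apply: measurable_funM => //; exact: measurable_fst.
apply: (eq_measurable_fun G) (measurable_funTS mG) => p; rewrite inE => p0.
by rewrite /G powR_inv1 ?mulr_ge0 ?ltW// -enorm_sqr.
Qed.

Lemma measurable_rV_sub disp (T : measurableType disp) (f g : T -> 'rV[R]_d) :
  measurable_fun setT f -> measurable_fun setT g ->
  measurable_fun setT (fun x => f x - g x).
Proof.
move=> mf mg; apply: measurable_fun_rV => i; under eq_fun do rewrite !mxE.
by apply: measurable_funB; exact: measurableT_comp (measurable_rV_coord i) _.
Qed.

Lemma measurable_heat_kernel_comp disp (T : measurableType disp)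
    (D : set T) (t : T -> R) (f : T -> 'rV[R]_d) : measurable D ->
  (forall x, D x -> 0 < t x) -> measurable_fun D t -> measurable_fun D f ->
  measurable_fun D (fun x => heat_kernel (t x) (f x)).
Proof.
move=> mD t0 mt mf.
apply: (measurable_comp (F := space_time) (f := fun p => heat_kernel p.1 p.2)
  (g := fun x => (t x, f x))).
- exact: measurable_space_time.
- by move=> _ [x Dx <-]; exact: t0.
- exact: measurable_heat_kernel.
- exact: measurable_fun_pair_in.
Qed.

Lemma measurable_heat_kernel_sub (t : R) (x : 'rV[R]_d) : 0 < t ->
  measurable_fun [set: 'rV[R]_d] (fun y => heat_kernel t (x - y)).
Proof.
by move=> t0; apply: measurable_heat_kernel_comp => //; exact: measurable_rV_sub.
Qed.

Lemma emeasurable_heat_kernel_sub (t : R) (x : 'rV[R]_d) : 0 < t ->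
  measurable_fun [set: 'rV[R]_d] (fun y => (heat_kernel t (x - y))%:E).
Proof. by move=> t0; apply/measurable_EFinP; exact: measurable_heat_kernel_sub. Qed.

End kernel_measurable.

Section kernel_integral.
Context {R : realType}.
Implicit Types (s t : R).

Lemma integral_heat_kernel d t (x : 'rV[R]_d) : 0 < t ->
  (\int[lebesgue_rV d]_y (heat_kernel t (x - y))%:E = 1)%E.
Proof.
move=> t0; elim: d x => [|d IH] x.
  rewrite integral_dirac//=; last exact: emeasurable_heat_kernel_sub.
  rewrite diracE in_setT mul1e /heat_kernel enorm_sqr big_ord0.
  by rewrite !mul0r !oppr0 powRr0 expR0 mul1r.
rewrite integral_lebesgue_rVS; last 2 first.
- exact: emeasurable_heat_kernel_sub.
- by move=> y; rewrite lee_fin heat_kernel_ge0.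
rewrite -(rV_unconsK x); case: (rV_uncons x) => a {}x.
rewrite -(integral_normal_pdf a (Num.sqrt t)); apply: eq_integral => b _.
under eq_integral do rewrite heat_kernel_rV_cons// EFinM.
rewrite ge0_integralZl_EFin ?normal_pdf_ge0// ?IH ?mule1//.
- by move=> y _; rewrite lee_fin heat_kernel_ge0.
- exact: emeasurable_heat_kernel_sub.
Qed.

Lemma chapman_kolmogorov d s t (x z : 'rV[R]_d) : 0 < s -> 0 < t ->
  (\int[lebesgue_rV d]_y (heat_kernel s (x - y) * heat_kernel t (y - z))%:E =
   (heat_kernel (s + t) (x - z))%:E)%E.
Proof.
move=> s0 t0.
have mK n (u v : 'rV[R]_n) : measurable_fun [set: 'rV[R]_n]
    (fun y => (heat_kernel s (u - y) * heat_kernel t (y - v))%:E).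
  apply/measurable_EFinP; apply: measurable_funM.
    exact: measurable_heat_kernel_sub.
  by under eq_fun do rewrite heat_kernelC; exact: measurable_heat_kernel_sub.
have K0 n (u v y : 'rV[R]_n) :
    (0 <= (heat_kernel s (u - y) * heat_kernel t (y - v))%:E)%E.
  by rewrite lee_fin mulr_ge0 ?heat_kernel_ge0.
elim: d x z => [|d IH] x z.
  rewrite integral_dirac//=; last exact: mK.
  rewrite diracE in_setT mul1e /heat_kernel !enorm_sqr !big_ord0.
  by rewrite !mul0r !oppr0 !powRr0 expR0 !mul1r.
rewrite integral_lebesgue_rVS//.
rewrite -(rV_unconsK x) -(rV_unconsK z).
case: (rV_uncons x) (rV_uncons z) => a {}x [c {}z].
rewrite heat_kernel_rV_cons ?addr_gt0// EFinM -IH.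
(* The dependence on the first coordinate b of the intermediate point is confined to a normal
   density, which integrates to 1; the inner integral is the identity in dimension d. *)
transitivity (\int[@lebesgue_measure R]_b
   ((normal_pdf a (Num.sqrt (s + t)) c)%:E *
   \int[lebesgue_rV d]_y (heat_kernel s (x - y) * heat_kernel t (y - z))%:E *
   (normal_pdf ((t * a + s * c) / (s + t)) (Num.sqrt (s * t / (s + t))) b)%:E))%E.
  apply: eq_integral => b _.
  under eq_integral => y _.
    rewrite heat_kernel_rV_cons// [X in _ * X]heat_kernelC heat_kernel_rV_cons//.
    rewrite mulrACA normal_pdf_prod// EFinM [heat_kernel t _]heat_kernelC; over.
  rewrite ge0_integralZl_EFin ?mulr_ge0 ?normal_pdf_ge0//.
  by rewrite EFinM muleAC.
rewrite IH -EFinM; under eq_integral do rewrite -EFinM EFinM.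
rewrite ge0_integralZl_EFin ?mulr_ge0 ?normal_pdf_ge0 ?powR_ge0//.
- by rewrite integral_normal_pdf mule1.
- by move=> y _; rewrite lee_fin normal_pdf_ge0.
- by apply/measurable_EFinP; exact: measurable_normal_pdf.
Qed.

End kernel_integral.

Section powR_limits.
Context {R : realType}.

Lemma cvg_powR (T : Type) (F : set_system T) (FF : Filter F) (f : T -> R) (a r : R) :
  0 < a -> f i @[i --> F] --> a -> f i `^ r @[i --> F] --> a `^ r.
Proof.
move=> a0 fa.
have ca : {for a, continuous (@powR R ^~ r)}.
  apply/differentiable_continuous/derivable1_diffP.
  by apply: derivable_powR; rewrite in_itv/= a0.
exact: (@cvg_comp _ _ _ f (@powR R ^~ r) _ _ _ fa ca).
Qed.

(** [cvg_powR] differentiates the power at a positive point, which fails at 0 for r < 1; here the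
    threshold e^(1/r) is used directly. *)
Lemma cvg_powR0 (T : Type) (F : set_system T) (FF : Filter F) (f : T -> R) (r : R) :
  0 < r -> (forall i, 0 <= f i) -> f i @[i --> F] --> 0 -> f i `^ r @[i --> F] --> 0.
Proof.
move=> r0 f0 /cvgr0Pnorm_lt fa; apply/cvgr0Pnorm_lt => e e0.
have e'0 : 0 < e `^ r^-1 by rewrite powR_gt0.
apply: filterS (fa _ e'0) => i; rewrite !ger0_norm ?powR_ge0// => h.
rewrite -[e](powRr1 (ltW e0)) -(mulVf (lt0r_neq0 r0)) powRrM.
by apply: gt0_ltr_powR => //; rewrite nnegrE ?powR_ge0.
Qed.

End powR_limits.

Section kernel_continuity.
Context {R : realType} {d : nat}.
Implicit Types (t r : R) (x y : 'rV[R]_d).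

Lemma cvg_enorm_sqr (T : Type) (F : set_system T) (FF : Filter F)
    (x_ : T -> 'rV[R]_d) x : x_ i @[i --> F] --> x ->
  enorm (x_ i) ^+ 2 @[i --> F] --> enorm x ^+ 2.
Proof.
move=> xx.
rewrite enorm_sqr (_ : (fun i => _) = fun i => \sum_(j < d) x_ i ord0 j ^+ 2).
  elim: (index_enum _) => [|j r IH].
    rewrite big_nil (_ : (fun i => _) = cst 0); first exact: cvg_cst.
    by apply/funext => i; rewrite big_nil.
  rewrite big_cons (_ : (fun i => _) =
      fun i => x_ i ord0 j * x_ i ord0 j + \sum_(k <- r) x_ i ord0 k ^+ 2).
    have xj : (x_ i ord0 j) @[i --> F] --> x ord0 j.
      apply: (@cvg_comp _ _ _ x_ (fun x => x ord0 j) _ _ _ xx).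
      exact: coord_continuous.
    by apply: cvgD IH; exact: cvgM.
  by apply/funext => i; rewrite big_cons expr2.
by apply/funext => i; rewrite enorm_sqr.
Qed.

Lemma cvg_heat_kernel (T : Type) (F : set_system T) (FF : Filter F)
    (t_ : T -> R) (x_ : T -> 'rV[R]_d) t x : 0 < t ->
  t_ i @[i --> F] --> t -> x_ i @[i --> F] --> x ->
  heat_kernel (t_ i) (x_ i) @[i --> F] --> heat_kernel t x.
Proof.
move=> t0 tt xx.
have t20 : 0 < 2 * t by rewrite mulr_gt0.
have p0 : 0 < 2 * pi * t by rewrite !mulr_gt0 ?pi_gt0.
have hS := cvg_enorm_sqr FF xx.
apply: cvgM.
  by apply: cvg_powR => //; apply: cvgM => //; exact: cvg_cst.
apply: (cvg_comp _ (@expR R) _ (@continuous_expR R _)).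
apply: cvgN; apply: cvgM; last first.
  by apply: cvgV; [exact: lt0r_neq0|apply: cvgM => //; exact: cvg_cst].
exact: hS.
Qed.

Lemma continuous_heat_kernel_sub t x : 0 < t ->
  continuous (fun y => heat_kernel t (x - y)).
Proof.
move=> t0 y.
apply: (@cvg_heat_kernel _ (nbhs y) _ (fun=> t) (fun y => x - y) t (x - y)) => //.
  exact: cvg_cst.
by apply: cvgB; [exact: cvg_cst|exact: cvg_id].
Qed.

Lemma enorm_sqrB_le x y z :
  enorm (x - y) ^+ 2 <= 2 * enorm (z - y) ^+ 2 + 2 * enorm (z - x) ^+ 2.
Proof.
rewrite !enorm_sqr !mulr_sumr -big_split/=; apply: ler_sum => i _.
rewrite !mxE; set a := x _ _; set b := y _ _; set c := z _ _.
rewrite -subr_ge0 (_ : _ - _ = ((c - b) + (c - a)) ^+ 2) ?sqr_ge0//; ring.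
Qed.

(** A dominating function when time and point move together. Since |x - y|^2 <= 2 |x' - y|^2 + 2,
    passing from the largest time 2r to 4r absorbs the factor 2 and leaves exp(1/(4r)); the
    prefactor is largest at the smallest time r/2. *)
Lemma heat_kernel_dominated r : 0 < r -> exists2 C, 0 <= C &
  forall r' x x' y, r / 2 <= r' -> r' <= 2 * r -> enorm (x' - x) ^+ 2 <= 1 ->
    heat_kernel r' (x' - y) <= C * heat_kernel (4 * r) (x - y).
Proof.
move=> r0; pose e : R := d%:R / 2.
have e0 : 0 <= e by rewrite divr_ge0.
have pi0 := pi_gt0 R.
exists ((2 * pi * (r / 2)) `^ (- e) / (2 * pi * (4 * r)) `^ (- e) * expR (4 * r)^-1).
  by rewrite mulr_ge0 ?expR_ge0// divr_ge0 ?powR_ge0.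
move=> r' x x' y r1 r2 xx'.
have r'0 : 0 < r' by rewrite (lt_le_trans _ r1)// divr_gt0.
rewrite /heat_kernel -/e mulrACA divfK; last first.
  by rewrite gt_eqF// powR_gt0 // !mulr_gt0.
rewrite -expRD; apply: ler_pM; rewrite ?powR_ge0 ?expR_ge0//.
  rewrite !powRN lef_pV2 ?posrE ?powR_gt0 ?mulr_gt0 ?divr_gt0//.
  apply: ge0_ler_powR; rewrite ?nnegrE ?ler_pM2l ?mulr_gt0//.
    by rewrite !mulr_ge0 ?divr_ge0 ?ltW.
  by rewrite !mulr_ge0 ?ltW.
rewrite ler_expR.
have h := enorm_sqrB_le x y x'.
have s0 := sqr_ge0 (enorm (x' - y)).
set a := enorm (x' - y) ^+ 2 in h s0 *; set b := enorm (x - y) ^+ 2 in h *.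
apply: (@le_trans _ _ (- (a / (4 * r)))).
  rewrite lerN2 ler_wpM2l// lef_pV2 ?posrE ?mulr_gt0//; lra.
have -> : (4 * r)^-1 - b / (2 * (4 * r)) = - ((b / 2 - 1) / (4 * r)).
  by field; exact: lt0r_neq0.
rewrite lerN2 ler_pM2r ?invr_gt0 ?mulr_gt0//; nra.
Qed.

End kernel_continuity.

(** * The heat semigroup and the Duhamel operator *)

(** The graph of a concave power lies below its tangent at m. This is Young's inequality with
    exponents 1/gamma and 1/(1 - gamma), applied to (r/m)^gamma and 1. *)
Lemma powR_le_tangent {R : realType} (gamma m r : R) :
  0 < gamma -> gamma < 1 -> 0 < m -> 0 <= r ->
  r `^ gamma <= gamma * m `^ (gamma - 1) * r + (1 - gamma) * m `^ gamma.
Proof.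
move=> g0 g1 m0 r0.
have g1' : 0 < 1 - gamma by rewrite subr_gt0.
have gn0 := lt0r_neq0 g0; have mn0 := lt0r_neq0 m0.
have rm0 : 0 <= r / m by rewrite divr_ge0// ltW.
have h : (r / m) `^ gamma <= r / m * gamma + (1 - gamma).
  have := @conjugate_powR R ((r / m) `^ gamma) 1 gamma^-1 (1 - gamma)^-1.
  rewrite powR1 !invrK mulr1 mul1r -powRrM divff// powRr1//; apply => //.
  - exact: powR_ge0.
  - by rewrite invr_gt0.
  - by rewrite invr_gt0.
  - by rewrite addrC subrK.
have -> : r `^ gamma = (r / m) `^ gamma * m `^ gamma.
  by rewrite -powRM ?divfK// ltW.
apply: le_trans (ler_wpM2r (powR_ge0 m gamma) h) _.
rewrite powRB; last by apply/implyP.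
rewrite (powRr1 (ltW m0)) le_eqVlt; apply/orP; left; apply/eqP; field.
exact: lt0r_neq0.
Qed.

Section heat_measure_theory.
Context {R : realType} {d : nat}.
Implicit Types (t s : R) (x y : 'rV[R]_d).
Local Open Scope ereal_scope.

Lemma heat_measure_ge0 t (mu : {measure set 'rV[R]_d -> \bar R}) x :
  0 <= heat_measure t mu x.
Proof. by apply: integral_ge0 => y _; rewrite lee_fin heat_kernel_ge0. Qed.

Lemma heat_measure_le t (mu : {measure set 'rV[R]_d -> \bar R}) x : (0 < t)%R ->
  heat_measure t mu x <= ((2 * pi * t) `^ (- (d%:R / 2)))%:E * mu setT.
Proof.
move=> t0; rewrite -integral_cst//; apply: ge0_le_integral => //.
- by move=> y _; rewrite lee_fin heat_kernel_ge0.
- exact: emeasurable_heat_kernel_sub.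
- by move=> y _; rewrite lee_fin heat_kernel_le.
Qed.

Lemma heat_measure_gt0 t (mu : {measure set 'rV[R]_d -> \bar R}) x : (0 < t)%R ->
  mu setT != 0 -> 0 < heat_measure t mu x.
Proof.
move=> t0 mu0; rewrite lt_neqAle heat_measure_ge0 andbT eq_sym.
apply: contra mu0 => /eqP h.
have mK := emeasurable_heat_kernel_sub x t0.
have : \int[mu]_y `|(heat_kernel t (x - y))%:E| = 0.
  by rewrite -h; apply: eq_integral => y _; rewrite gee0_abs// lee_fin heat_kernel_ge0.
(* A zero integral makes the kernel vanish almost everywhere; as it vanishes nowhere, the
   exceptional null set is the whole space. *)
move/(ae_eq_integral_abs mu measurableT mK) => [N [mN N0 sN]].
rewrite -measure_le0 -N0 le_measure ?inE// => y _; apply: sN => /= /(_ I) [] e.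
by have := heat_kernel_gt0 (x - y) t0; rewrite e ltxx.
Qed.

Lemma heat_measure_lty t (mu : {finite_measure set 'rV[R]_d -> \bar R}) x :
  (0 < t)%R -> heat_measure t mu x < +oo.
Proof.
move=> t0; apply: le_lt_trans (heat_measure_le mu x t0) _.
rewrite lte_mul_pinfty ?lee_fin ?powR_ge0//.
by rewrite -ge0_fin_numE// fin_num_measure.
Qed.

Lemma heat_measure_fin_num t (mu : {finite_measure set 'rV[R]_d -> \bar R}) x :
  (0 < t)%R -> heat_measure t mu x \is a fin_num.
Proof. by move=> t0; rewrite ge0_fin_numE ?heat_measure_ge0// heat_measure_lty. Qed.

Lemma measurable_heat_measure (mu : {sigma_finite_measure set 'rV[R]_d -> \bar R}) :
  measurable_fun (@space_time R d) (fun p => heat_measure p.1 mu p.2).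
Proof.
pose D := [set q : (R * 'rV[R]_d) * 'rV[R]_d | (0 < q.1.1)%R].
have mD : measurable D.
  rewrite (_ : D = fst @^-1` (@space_time R d))//.
  rewrite -[X in measurable X]setTI; apply: measurable_fst => //.
  exact: measurable_space_time.
pose f (q : (R * 'rV[R]_d) * 'rV[R]_d) := heat_kernel q.1.1 (q.1.2 - q.2).
have mf : measurable_fun D f.
  apply: measurable_heat_kernel_comp => //.
    by apply: measurable_funTS; exact: measurableT_comp measurable_fst measurable_fst.
  apply: measurable_funTS; apply: measurable_rV_sub; last exact: measurable_snd.
  exact: measurableT_comp measurable_snd measurable_fst.
(* Extension by 0 to nonpositive times gives a function on the whole product, to which Tonelli's
   theorem applies. *)
pose g := f \_ D.
have g0 q : (0 <= (g q)%:E).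
  by rewrite lee_fin /g patchE; case: ifP => // _; exact: heat_kernel_ge0.
have mg : measurable_fun setT (EFin \o g).
  by apply/measurable_EFinP/(measurable_restrictT _ mD).
apply: (eq_measurable_fun (fubini_F mu (EFin \o g))); last first.
  by apply: measurable_funTS; exact: measurable_fun_fubini_tonelli_F.
move=> p; rewrite inE => p0; apply: eq_integral => y _.
by rewrite /= /g patchE mem_set.
Qed.

Lemma heat_measure_semigroup s t (mu : {sigma_finite_measure set 'rV[R]_d -> \bar R}) x :
  (0 < s)%R -> (0 < t)%R ->
  \int[lebesgue_rV d]_y ((heat_kernel s (x - y))%:E * heat_measure t mu y) =
  heat_measure (s + t) mu x.
Proof.
move=> s0 t0.
have mK1 : measurable_fun setT (fun p : 'rV[R]_d * 'rV[R]_d => heat_kernel s (x - p.1)).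
  by apply: measurable_heat_kernel_comp => //; apply: measurable_rV_sub.
have mK2 : measurable_fun setT (fun p : 'rV[R]_d * 'rV[R]_d => heat_kernel t (p.1 - p.2)).
  by apply: measurable_heat_kernel_comp => //; apply: measurable_rV_sub.
pose f (p : 'rV[R]_d * 'rV[R]_d) :=
  ((heat_kernel s (x - p.1))%:E * (heat_kernel t (p.1 - p.2))%:E).
transitivity (\int[lebesgue_rV d]_y \int[mu]_z f (y, z)).
  apply: eq_integral => y _; rewrite /f/= ge0_integralZl_EFin//.
  - by move=> z _; rewrite lee_fin heat_kernel_ge0.
  - exact: emeasurable_heat_kernel_sub.
  - exact: heat_kernel_ge0.
rewrite fubini_tonelli.
- apply: eq_integral => z _; rewrite -(chapman_kolmogorov x z s0 t0).
  by apply: eq_integral => y _; rewrite /f EFinM.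
- by apply: emeasurable_funM; apply/measurable_EFinP.
- by move=> p; rewrite mule_ge0// lee_fin heat_kernel_ge0.
Qed.

End heat_measure_theory.

Section heat_fun_theory.
Context {R : realType} {d : nat}.
Implicit Types (t s : R) (x y : 'rV[R]_d) (f g : 'rV[R]_d -> R).
Local Open Scope ereal_scope.

Lemma measurable_heat_fun_integrand t f x : (0 < t)%R -> measurable_fun setT f ->
  measurable_fun setT (fun y => (heat_kernel t (x - y) * f y)%:E).
Proof.
move=> t0 mf; apply/measurable_EFinP; apply: measurable_funM => //.
exact: measurable_heat_kernel_sub.
Qed.

Lemma heat_fun_ge0 t f x : (forall y, (0 <= f y)%R) -> 0 <= heat_fun t f x.
Proof.
by move=> f0; apply: integral_ge0 => y _; rewrite lee_fin mulr_ge0 ?heat_kernel_ge0.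
Qed.

Lemma heat_fun_mono t f g x : (0 < t)%R -> measurable_fun setT f ->
  measurable_fun setT g -> (forall y, 0 <= f y <= g y)%R ->
  heat_fun t f x <= heat_fun t g x.
Proof.
move=> t0 mf mg fg; apply: ge0_le_integral => //.
- by move=> y _; have /andP[? _] := fg y; rewrite lee_fin mulr_ge0 ?heat_kernel_ge0.
- exact: measurable_heat_fun_integrand.
- exact: measurable_heat_fun_integrand.
- move=> y _; have /andP[? ?] := fg y.
  by rewrite lee_fin ler_wpM2l ?heat_kernel_ge0.
Qed.

Lemma heat_fun_lin t f g x (a b : R) : (0 < t)%R -> measurable_fun setT f ->
  measurable_fun setT g -> (forall y, 0 <= f y)%R -> (forall y, 0 <= g y)%R ->
  (0 <= a)%R -> (0 <= b)%R ->
  heat_fun t (fun y => a * f y + b * g y)%R x =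
  a%:E * heat_fun t f x + b%:E * heat_fun t g x.
Proof.
move=> t0 mf mg f0 g0 a0 b0.
have If h : (forall y, 0 <= h y)%R -> forall y, setT y ->
    0 <= (heat_kernel t (x - y) * h y)%:E.
  by move=> h0 y _; rewrite lee_fin mulr_ge0 ?heat_kernel_ge0.
have Mf := @measurable_heat_fun_integrand t _ x t0.
rewrite /heat_fun -!ge0_integralZl_EFin//; [|exact: If|exact: Mf|exact: If|exact: Mf].
rewrite -ge0_integralD//.
- apply: eq_integral => y _; rewrite -!EFinM -EFinD; congr (_%:E).
  by rewrite mulrDr; congr (_ + _)%R; rewrite mulrCA.
- by move=> y _; apply: mule_ge0; [rewrite lee_fin|exact: If].
- by apply: emeasurable_funM => //; exact: Mf.
- by move=> y _; apply: mule_ge0; [rewrite lee_fin|exact: If].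
- by apply: emeasurable_funM => //; exact: Mf.
Qed.

Lemma heat_fun_cst t x (c : R) : (0 < t)%R -> (0 <= c)%R ->
  heat_fun t (fun=> c) x = c%:E.
Proof.
move=> t0 c0; rewrite /heat_fun; under eq_integral do rewrite mulrC EFinM.
rewrite ge0_integralZl_EFin ?integral_heat_kernel ?mule1//.
- by move=> y _; rewrite lee_fin heat_kernel_ge0.
- exact: emeasurable_heat_kernel_sub.
Qed.

(* Jensen's inequality for r |-> r^gamma, from its tangent at m. *)
Lemma heat_fun_powR_le t f x (gamma m : R) : (0 < t)%R -> measurable_fun setT f ->
  (forall y, 0 <= f y)%R -> (0 < gamma < 1)%R -> (0 < m)%R ->
  heat_fun t f x <= m%:E ->
  heat_fun t (fun y => f y `^ gamma)%R x <= (m `^ gamma)%:E.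
Proof.
move=> t0 mf f0 /andP[g0 g1] m0 fm.
have g1' : (0 < 1 - gamma)%R by rewrite subr_gt0.
have tangent := powR_le_tangent g0 g1 m0.
have mfg : measurable_fun setT (fun y => f y `^ gamma)%R.
  exact: measurableT_comp (@measurable_powR R gamma) mf.
apply: (@le_trans _ _ (heat_fun t (fun y => (gamma * m `^ (gamma - 1)) * f y +
    ((1 - gamma) * m `^ gamma) * (cst 1 y))%R x)).
  apply: heat_fun_mono => //.
    by apply: measurable_funD => //; exact: measurable_funM.
  by move=> y; rewrite powR_ge0 mulr1 tangent.
have c0 : (0 <= gamma * m `^ (gamma - 1))%R by rewrite mulr_ge0 ?powR_ge0 ?ltW.
rewrite heat_fun_lin ?heat_fun_cst//; last by rewrite mulr_ge0 ?powR_ge0 ?ltW.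
apply: (@le_trans _ _ ((gamma * m `^ (gamma - 1))%:E * m%:E +
   ((1 - gamma) * m `^ gamma)%:E * 1)).
  by rewrite leeD2r// lee_wpmul2l.
rewrite mule1 -EFinM -EFinD lee_fin powRB; last by apply/implyP => _; exact: lt0r_neq0.
rewrite (powRr1 (ltW m0)) le_eqVlt; apply/orP; left; apply/eqP; field.
exact: lt0r_neq0.
Qed.

End heat_fun_theory.

Section duhamel.
Context {R : realType} {d : nat}.
Implicit Types (t s : R) (x y : 'rV[R]_d) (g v : R -> 'rV[R]_d -> R).
Local Open Scope ereal_scope.

Definition duhamel g t x : \bar R :=
  \int[@lebesgue_measure R]_(s in `]0%R, t[) heat_fun (t - s) (g s) x.

Definition nonneg_measurable g : Prop :=
  measurable_fun (@space_time R d) (fun p => g p.1 p.2) /\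
  forall s y, (0 < s)%R -> (0 <= g s y)%R.

Lemma measurable_slice disp (T : measurableType disp) (f : R * 'rV[R]_d -> T) s :
  measurable_fun (@space_time R d) f -> (0 < s)%R ->
  measurable_fun [set: 'rV[R]_d] (fun y => f (s, y)).
Proof.
move=> mf s0; apply: (measurable_comp (F := space_time) _ _ mf).
- exact: measurable_space_time.
- by move=> _ [y _ <-].
- exact: pair1_measurable.
Qed.

Lemma nonneg_measurable_powR g (r : R) : nonneg_measurable g ->
  nonneg_measurable (fun s y => g s y `^ r)%R.
Proof.
move=> [mg g0]; split=> [|s y s0]; last exact: powR_ge0.
exact: measurableT_comp (@measurable_powR R r) mg.
Qed.

(** The Duhamel integrand at the target p and the source q, extended by 0 outside 0 < q.1 < p.1: it
    is nonnegative and measurable in all variables at once, so that Tonelli applies to any grouping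
    of them. *)
Let G g (p q : R * 'rV[R]_d) : \bar R :=
  if (0 < q.1 < p.1)%R then (heat_kernel (p.1 - q.1) (p.2 - q.2) * g q.1 q.2)%:E
  else 0.

Let G_ge0 g p q : nonneg_measurable g -> 0 <= G g p q.
Proof.
move=> [_ g0]; rewrite /G; case: ifPn => // /andP[q0 _].
by rewrite lee_fin mulr_ge0 ?heat_kernel_ge0 ?g0.
Qed.

Let mG g : nonneg_measurable g ->
  measurable_fun setT (fun pq : (R * 'rV[R]_d) * (R * 'rV[R]_d) => G g pq.1 pq.2).
Proof.
move=> [mg g0].
have m11 : measurable_fun setT (fun pq : (R * 'rV[R]_d) * (R * 'rV[R]_d) => pq.1.1).
  exact: measurableT_comp measurable_fst measurable_fst.
have m12 : measurable_fun setT (fun pq : (R * 'rV[R]_d) * (R * 'rV[R]_d) => pq.1.2).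
  exact: measurableT_comp measurable_snd measurable_fst.
have m21 : measurable_fun setT (fun pq : (R * 'rV[R]_d) * (R * 'rV[R]_d) => pq.2.1).
  exact: measurableT_comp measurable_fst measurable_snd.
have m22 : measurable_fun setT (fun pq : (R * 'rV[R]_d) * (R * 'rV[R]_d) => pq.2.2).
  exact: measurableT_comp measurable_snd measurable_snd.
have mb : measurable_fun setT
    (fun pq : (R * 'rV[R]_d) * (R * 'rV[R]_d) => (0 < pq.2.1 < pq.1.1)%R).
  by apply: measurable_and; exact: measurable_fun_ltr.
apply: measurable_fun_if => //.
set D := _ `&` _.
have mD : measurable D by apply: mb.
have DP pq : D pq -> (0 < pq.2.1 < pq.1.1)%R by case.
apply/measurable_EFinP; apply: measurable_funM.
  apply: measurable_heat_kernel_comp => //.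
  - by move=> pq /DP /andP[_]; rewrite subr_gt0.
  - by apply: measurable_funTS; exact: measurable_funB.
  - by apply: measurable_funTS; exact: measurable_rV_sub.
apply: (measurable_comp (F := space_time) (f := fun p => g p.1 p.2)
  (g := snd)) => //; first exact: measurable_space_time.
  by move=> _ [pq /DP /andP[? _] <-].
exact: measurable_funTS.
Qed.

Let mG2 g p : nonneg_measurable g -> measurable_fun setT (G g p).
Proof. by move=> mg; exact: (measurable_fun_pair2 _ (mG mg)). Qed.

(* The product of the Lebesgue measures on R and R^d is handled as the Lebesgue
   measure on R^(d+1), which is registered as a sigma-finite measure. *)
Let integral_rV_uncons (F : R * 'rV[R]_d -> \bar R) :
  measurable_fun setT F -> (forall q, 0 <= F q) ->
  \int[lebesgue_rV d.+1]_q F (rV_uncons q) =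
  \int[@lebesgue_measure R]_s \int[lebesgue_rV d]_y F (s, y).
Proof.
move=> mF F0.
have mFu : measurable_fun setT (fun q => F (rV_uncons q)).
  exact: measurableT_comp mF (@measurable_rV_uncons R d).
rewrite (integral_lebesgue_rVS mFu) => [|q]; last exact: F0.
by apply: eq_integral => s _; apply: eq_integral => y _; rewrite rV_consK.
Qed.

Let GE g t x s : (\int[lebesgue_rV d]_y G g (t, x) (s, y)) =
  ((fun s => heat_fun (t - s) (g s) x) \_ `]0%R, t[) s.
Proof.
rewrite patchE; case: ifPn.
  by rewrite inE/= in_itv/= => st; apply: eq_integral => y _; rewrite /G /= st.
rewrite notin_setE/= in_itv/= => /negP/negbTE st.
by rewrite -[RHS](integral0 (lebesgue_rV d) setT); apply: eq_integral => y _; rewrite /G /= st.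
Qed.

Let duhamelE g t x : nonneg_measurable g ->
  duhamel g t x = \int[lebesgue_rV d.+1]_q G g (t, x) (rV_uncons q).
Proof.
move=> mg; rewrite /duhamel integral_mkcond.
rewrite integral_rV_uncons; [|exact: mG2|by move=> q; exact: G_ge0].
by apply: eq_integral => s _; rewrite -GE.
Qed.

Lemma measurable_heat_fun_time g t x : nonneg_measurable g ->
  measurable_fun `]0%R, t[ (fun s => heat_fun (t - s) (g s) x).
Proof.
move=> mg; apply/(measurable_restrictT _ (measurable_itv _)).
rewrite -(funext (GE g t x)).
apply: (@measurable_fun_fubini_tonelli_F _ _ _ _ R (lebesgue_rV d) (G g (t, x))).
- exact: mG2.
- by move=> q; exact: G_ge0.
Qed.

Lemma measurable_duhamel g : nonneg_measurable g ->
  measurable_fun (@space_time R d) (fun p => duhamel g p.1 p.2).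
Proof.
move=> mg; apply: measurable_funTS.
pose f (pq : (R * 'rV[R]_d) * 'rV[R]_d.+1) := G g pq.1 (rV_uncons pq.2).
rewrite (_ : (fun p => _) = fubini_F (lebesgue_rV d.+1) f).
  apply: measurable_fun_fubini_tonelli_F => [|pq]; last exact: G_ge0.
  apply: (measurableT_comp (f := fun pq => G g pq.1 pq.2)
    (g := fun pq : (R * 'rV[R]_d) * 'rV[R]_d.+1 => (pq.1, rV_uncons pq.2))).
    exact: mG.
  apply: measurable_fun_pair => //.
  exact: measurableT_comp (@measurable_rV_uncons R d) measurable_snd.
by apply/funext => -[t x]; rewrite duhamelE.
Qed.

Lemma duhamel_ge0 g t x : nonneg_measurable g -> 0 <= duhamel g t x.
Proof.
move=> [_ g0]; apply: integral_ge0 => s /=; rewrite in_itv/= => /andP[s0 _].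
by apply: heat_fun_ge0 => y; exact: g0.
Qed.

(** Tonelli moves the outer kernel inside, and Chapman-Kolmogorov merges the times t - s and s - r
    into t - r. *)
Lemma heat_duhamel g t s x : nonneg_measurable g -> (0 < s < t)%R ->
  \int[lebesgue_rV d]_y ((heat_kernel (t - s) (x - y))%:E * duhamel g s y) =
  \int[@lebesgue_measure R]_(r in `]0%R, s[) heat_fun (t - r) (g r) x.
Proof.
move=> mg /andP[s0 st]; have ts0 : (0 < t - s)%R by rewrite subr_gt0.
have [_ g0] := mg.
pose f (yq : 'rV[R]_d * (R * 'rV[R]_d)) :=
  (heat_kernel (t - s) (x - yq.1))%:E * G g (s, yq.1) yq.2.
have f0 yq : 0 <= f yq by rewrite mule_ge0 ?G_ge0// lee_fin heat_kernel_ge0.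
have mf : measurable_fun setT f.
  apply: emeasurable_funM.
    apply/measurable_EFinP.
    exact: measurableT_comp (measurable_heat_kernel_sub x ts0) measurable_fst.
  apply: (measurableT_comp (f := fun pq : (R * 'rV[R]_d) * (R * 'rV[R]_d) => G g pq.1 pq.2)
    (g := fun yq : 'rV[R]_d * (R * 'rV[R]_d) => ((s, yq.1), yq.2))); first exact: mG.
  by apply: measurable_fun_pair => //; apply: measurable_fun_pair.
pose f' (yq : 'rV[R]_d * 'rV[R]_d.+1) := f (yq.1, rV_uncons yq.2).
have mf' : measurable_fun setT f'.
  apply: (measurableT_comp mf); apply: measurable_fun_pair => //.
  exact: measurableT_comp (@measurable_rV_uncons R d) measurable_snd.
transitivity (\int[lebesgue_rV d]_y \int[lebesgue_rV d.+1]_q f' (y, q)).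
  apply: eq_integral => y _; rewrite duhamelE// /f' /f/= ge0_integralZl_EFin//.
  - by move=> q _; exact: G_ge0.
  - exact: measurableT_comp (mG2 _ mg) (@measurable_rV_uncons R d).
  - exact: heat_kernel_ge0.
rewrite fubini_tonelli//; last by move=> q; exact: f0.
pose H (q : R * 'rV[R]_d) : \bar R := \int[lebesgue_rV d]_y f (y, q).
have mH : measurable_fun setT H.
  exact: (@measurable_fun_fubini_tonelli_G _ _ _ _ R (lebesgue_rV d) f mf f0).
have H0 q : 0 <= H q by exact: integral_ge0.
rewrite -[LHS]/(\int[lebesgue_rV d.+1]_q H (rV_uncons q)) (integral_rV_uncons mH H0).
rewrite [RHS]integral_mkcond.
apply: eq_integral => r _; rewrite patchE; case: ifPn.
  rewrite inE/= in_itv/= => /andP[r0 rs].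
  have sr0 : (0 < s - r)%R by rewrite subr_gt0.
  apply: eq_integral => z _; rewrite /H /f /G /= r0 rs /=.
  transitivity (\int[lebesgue_rV d]_y ((g r z)%:E *
      (heat_kernel (t - s) (x - y) * heat_kernel (s - r) (y - z))%:E)).
    by apply: eq_integral => y _; rewrite -!EFinM mulrA; congr (_%:E); exact: mulrC.
  rewrite ge0_integralZl_EFin ?g0//.
  - by rewrite chapman_kolmogorov// addrA subrK -EFinM; congr (_%:E); exact: mulrC.
  - by move=> y _; rewrite lee_fin mulr_ge0 ?heat_kernel_ge0.
  apply/measurable_EFinP; apply: measurable_funM.
    exact: measurable_heat_kernel_sub.
  by under eq_fun do rewrite heat_kernelC; exact: measurable_heat_kernel_sub.
rewrite notin_setE/= in_itv/= => /negP/negbTE rs.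
rewrite -[RHS](integral0 (lebesgue_rV d) setT); apply: eq_integral => z _.
rewrite /H -[RHS](integral0 (lebesgue_rV d) setT); apply: eq_integral => y _.
by rewrite /f /G /= rs mule0.
Qed.

(** S_{t-s} turns the mild equation at time s into the one at time t with the time integral stopped
    at s. For fixed (t, x), this is the integral equation in s that is compared with the scalar
    one. *)
Lemma heat_mild g v (mu : {sigma_finite_measure set 'rV[R]_d -> \bar R}) t s x :
  nonneg_measurable g -> (0 < s < t)%R ->
  (forall y, (v s y)%:E = heat_measure s mu y + duhamel g s y) ->
  heat_fun (t - s) (v s) x = heat_measure t mu x +
    \int[@lebesgue_measure R]_(r in `]0%R, s[) heat_fun (t - r) (g r) x.
Proof.
move=> mg st vE; have /andP[s0 s_t] := st.
have ts0 : (0 < t - s)%R by rewrite subr_gt0.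
have mK := emeasurable_heat_kernel_sub x ts0.
have K0 y : 0 <= (heat_kernel (t - s) (x - y))%:E by rewrite lee_fin heat_kernel_ge0.
rewrite -heat_duhamel//.
rewrite -[t in heat_measure t _ _](subrK s) -heat_measure_semigroup//.
rewrite -ge0_integralD//.
- apply: eq_integral => y _; rewrite EFinM vE ge0_muleDr ?duhamel_ge0//.
  exact: heat_measure_ge0.
- by move=> y _; rewrite mule_ge0// heat_measure_ge0.
- apply: emeasurable_funM => //.
  apply: (measurable_slice (f := fun p => heat_measure p.1 mu p.2)) => //.
  exact: measurable_heat_measure.
- by move=> y _; rewrite mule_ge0// duhamel_ge0.
- apply: emeasurable_funM => //.
  apply: (measurable_slice (f := fun p => duhamel g p.1 p.2)) => //.
  exact: measurable_duhamel.
Qed.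

End duhamel.

(** * The scalar equation *)

Section comparison_ode.
Context {R : realType}.
Variable gamma : R.
Hypothesis g01 : 0 < gamma < 1.
Implicit Types (a r s t c : R).

(* The solution at time s of y' = y ^ gamma, y 0 = a. *)
Definition ode_sol s a : R :=
  (a `^ (1 - gamma) + (1 - gamma) * s) `^ (1 - gamma)^-1.

Let g0 : 0 < gamma. Proof. by have /andP[] := g01. Qed.
Let p0 : 0 < 1 - gamma. Proof. by have /andP[] := g01; rewrite subr_gt0. Qed.
Let p0' : 0 <= 1 - gamma. Proof. exact: ltW. Qed.
Let q0 : 0 < (1 - gamma)^-1. Proof. by rewrite invr_gt0. Qed.
Let pq : (1 - gamma) * (1 - gamma)^-1 = 1. Proof. by rewrite divff// lt0r_neq0. Qed.

Let powK a : 0 <= a -> (a `^ (1 - gamma)) `^ (1 - gamma)^-1 = a.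
Proof. by move=> a0; rewrite -powRrM pq powRr1. Qed.

Lemma measurable_ode_pow c :
  measurable_fun setT (fun r => ((c + (1 - gamma) * r) `^ (1 - gamma)^-1) `^ gamma).
Proof.
apply: measurableT_comp (@measurable_powR R gamma) _.
apply: measurableT_comp (@measurable_powR R _) _.
by apply: measurable_funD => //; exact: measurable_funM.
Qed.

(** Fundamental theorem of calculus for F(r) = (c + (1 - gamma) r)^(1/(1 - gamma)), with F' =
    F^gamma because 1/(1 - gamma) - 1 = gamma/(1 - gamma). Positivity of the base at [s] keeps the
    power differentiable up to the left endpoint. *)
Lemma integral_ode_pow c s t : 0 <= c -> s < t -> 0 < c + (1 - gamma) * s ->
  (\int[@lebesgue_measure R]_(r in `]s, t[)
     (((c + (1 - gamma) * r) `^ (1 - gamma)^-1) `^ gamma)%:E =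
   ((c + (1 - gamma) * t) `^ (1 - gamma)^-1)%:E -
   ((c + (1 - gamma) * s) `^ (1 - gamma)^-1)%:E)%E.
Proof.
move=> c0 st cs.
pose f r := ((c + (1 - gamma) * r) `^ (1 - gamma)^-1) `^ gamma.
pose F r := (c + (1 - gamma) * r) `^ (1 - gamma)^-1.
have pos r : s <= r -> 0 < c + (1 - gamma) * r.
  by move=> sr; rewrite (lt_le_trans cs)// lerD2l ler_wpM2l// ltW.
have dA r : is_derive r 1 (fun r => c + (1 - gamma) * r) (1 - gamma).
  have := is_deriveD (is_derive_cst c r 1) (is_deriveZ (1 - gamma) (is_derive_id r 1)).
  by rewrite add0r scaler1.
have dF r : s <= r -> is_derive r 1 F (f r).
  move=> sr; have := @is_derive1_comp R (@powR R ^~ (1 - gamma)^-1)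
    (fun r => c + (1 - gamma) * r) r _ _ (is_derive1_powR _ (pos r sr)) (dA r).
  rewrite (_ : _ * _ * _ = f r)//.
  rewrite mulrAC mulVf ?lt0r_neq0// mul1r /f -powRrM; congr (_ `^ _).
  have := lt0r_neq0 p0 => h; field; exact: h.
have cF r : s <= r -> {for r, continuous F}.
  move=> sr; apply/differentiable_continuous/derivable1_diffP.
  by have [] := dF r sr.
have cf r : s <= r -> {for r, continuous f}.
  move=> sr; apply: cvg_powR; first by rewrite powR_gt0 ?pos.
  exact: cF.
rewrite -(integral_itv_bndoo true false) => [|]; last first.
  by apply/measurable_EFinP/measurable_funTS; exact: measurable_ode_pow.
apply: (@continuous_FTC2 R f F s t st).
- apply: continuous_in_subspaceT => r; rewrite inE/= in_itv/= => /andP[sr _].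
  exact: cf.
- split.
  + by move=> r; rewrite in_itv/= => /andP[/ltW sr _]; have [] := dF r sr.
  + by apply: cvg_at_right_filter; exact: cF.
  + by apply: cvg_at_left_filter; apply: cF; exact: ltW.
- move=> r; rewrite in_itv/= => /andP[/ltW sr _].
  by rewrite derive1E; apply: derive_val; exact: dF.
Qed.

Lemma ode_sol_integral a s : 0 < a -> 0 < s ->
  (a%:E + \int[@lebesgue_measure R]_(r in `]0%R, s[) (ode_sol r a `^ gamma)%:E =
   (ode_sol s a)%:E)%E.
Proof.
move=> a0 s0; rewrite integral_ode_pow//; last 2 first.
- exact: powR_ge0.
- by rewrite mulr0 addr0 powR_gt0.
by rewrite mulr0 addr0 -powRrM pq powRr1 ?ltW// addeC subeK.
Qed.

Lemma ode_sol0E s : ode_sol s 0 = ((1 - gamma) * s) `^ (1 - gamma)^-1.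
Proof. by rewrite /ode_sol powR0 ?add0r// lt0r_neq0. Qed.

(** The base of the power vanishes at time 0, so [integral_ode_pow] does not reach down to 0; the
    integral is cut at a small s, which costs [ode_sol s 0]. *)
Lemma ode_sol0_integral t : 0 < t ->
  ((ode_sol t 0)%:E <=
   \int[@lebesgue_measure R]_(r in `]0%R, t[) (ode_sol r 0 `^ gamma)%:E)%E.
Proof.
move=> t0; apply/lee_addgt0Pr => e e0.
(* The second entry gives (1 - gamma) s <= e^(1 - gamma), that is, [ode_sol s 0] at most e; the
   first keeps s below t. *)
pose s := Num.min (t / 2) (e `^ (1 - gamma) / (1 - gamma)).
have s0 : 0 < s by rewrite lt_min !divr_gt0// powR_gt0.
have st : s < t by rewrite gt_min ltr_pdivrMr// ltr_pMr// ltr1n.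
apply: (@le_trans _ _ (\int[@lebesgue_measure R]_(r in `]s, t[)
   (ode_sol r 0 `^ gamma)%:E + e%:E)%E); last first.
  rewrite leeD2r//; apply: ge0_subset_integral => //.
  - by apply/measurable_EFinP/measurable_funTS; exact: measurable_ode_pow.
  - by move=> r _; rewrite lee_fin powR_ge0.
  - by apply: subset_itvr; rewrite bnd_simp ltW.
rewrite integral_ode_pow ?powR_ge0//; last first.
  by rewrite ltr_wpDl ?powR_ge0// mulr_gt0.
rewrite -EFinB -EFinD lee_fin -addrA lerDl addrC subr_ge0.
rewrite -[leRHS](powK (ltW e0)); apply: ge0_ler_powR.
- exact: ltW.
- by rewrite nnegrE addr_ge0 ?powR_ge0// mulr_ge0 ?ltW.
- by rewrite nnegrE powR_ge0.
- by rewrite powR0 ?lt0r_neq0// add0r mulrC -ler_pdivlMr// ge_min lexx orbT.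
Qed.

Lemma ode_sol_ge0 s a : 0 <= ode_sol s a. Proof. exact: powR_ge0. Qed.

Lemma ode_sol_mono s a b : 0 <= s -> 0 <= a -> a <= b -> ode_sol s a <= ode_sol s b.
Proof.
move=> s0 a0 ab; apply: ge0_ler_powR.
- exact: ltW.
- by rewrite nnegrE addr_ge0 ?powR_ge0// mulr_ge0.
- by rewrite nnegrE addr_ge0 ?powR_ge0// mulr_ge0.
rewrite lerD2r; apply: ge0_ler_powR => //.
by rewrite nnegrE (le_trans a0).
Qed.

Lemma ode_sol_mono_time s t a : 0 <= s -> s <= t -> ode_sol s a <= ode_sol t a.
Proof.
move=> s0 st; have t0 := le_trans s0 st; apply: ge0_ler_powR.
- exact: ltW.
- by rewrite nnegrE addr_ge0 ?powR_ge0// mulr_ge0.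
- by rewrite nnegrE addr_ge0 ?powR_ge0// mulr_ge0.
- by rewrite lerD2l ler_wpM2l.
Qed.

Lemma le_ode_sol s a : 0 <= s -> 0 <= a -> a <= ode_sol s a.
Proof.
move=> s0 a0; rewrite -[leLHS](powK a0); apply: ge0_ler_powR.
- exact: ltW.
- by rewrite nnegrE powR_ge0.
- by rewrite nnegrE addr_ge0 ?powR_ge0// mulr_ge0.
- by rewrite lerDl mulr_ge0.
Qed.

(** Source of the upper bound of the theorem. With p = 1 - gamma, e^(tp) (a + 1)^p >= (1 + tp) (a +
    1)^p >= a^p + tp, because (a + 1)^p is at least a^p and at least 1. *)
Lemma ode_sol_le_exp t a : 0 <= t -> 0 <= a -> ode_sol t a <= expR t * a + expR t.
Proof.
move=> t0 a0; have a10 : 0 <= a + 1 by rewrite addr_ge0.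
have ea : 0 <= expR t * a + expR t by rewrite addr_ge0 ?mulr_ge0 ?expR_ge0.
rewrite -[leRHS](powK ea); apply: ge0_ler_powR.
- exact: ltW.
- by rewrite nnegrE addr_ge0 ?powR_ge0// mulr_ge0.
- by rewrite nnegrE powR_ge0.
rewrite (_ : _ + expR t = expR t * (a + 1)); last by ring.
rewrite powRM ?expR_ge0// -expRM.
have h1 : a `^ (1 - gamma) <= (a + 1) `^ (1 - gamma).
  by apply: ge0_ler_powR; rewrite ?nnegrE ?lerDl.
have h2 : 1 <= (a + 1) `^ (1 - gamma).
  rewrite -[leLHS](@powRr0 R (a + 1)); apply: ler_powR => //.
  by rewrite lerDr.
apply: (@le_trans _ _ ((1 + t * (1 - gamma)) * (a + 1) `^ (1 - gamma))).
  have : 0 <= t * (1 - gamma) by rewrite mulr_ge0.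
  nra.
by rewrite ler_wpM2r ?powR_ge0// expR_ge1Dx.
Qed.

(** Both summands under the outer power of [ode_sol] are at most m^(1 - gamma); the factor 2 for
    their sum leaves that power as 2^(1/(1 - gamma)). *)
Lemma ode_sol_le_max t a : 0 <= t -> 0 <= a ->
  ode_sol t a <= 2 `^ (1 - gamma)^-1 * Num.max a (ode_sol t 0).
Proof.
move=> t0 a0; set m := Num.max _ _.
have m0 : 0 <= m by rewrite le_max a0.
rewrite -[m in leRHS](powK m0) -powRM ?powR_ge0//.
have pt0 : 0 <= (1 - gamma) * t by rewrite mulr_ge0.
apply: ge0_ler_powR.
- exact: ltW.
- by rewrite nnegrE addr_ge0 ?powR_ge0.
- by rewrite nnegrE mulr_ge0 ?powR_ge0.
rewrite mulr_natl mulr2n; apply: lerD.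
  by apply: ge0_ler_powR; rewrite ?nnegrE// le_max lexx.
have -> : (1 - gamma) * t = ode_sol t 0 `^ (1 - gamma).
  by rewrite ode_sol0E -powRrM mulVf ?lt0r_neq0// powRr1.
by apply: ge0_ler_powR; rewrite ?nnegrE ?ode_sol_ge0// le_max lexx orbT.
Qed.

End comparison_ode.

(** * Limits of the Duhamel operator *)

Section dominated_convergence_near.
Local Open Scope ereal_scope.
Context disp (T : measurableType disp) (R : realType).
Variables (mu : {measure set T -> \bar R}) (D : set T).
Variables (f_ : (T -> \bar R)^nat) (f : T -> \bar R) (g : T -> R).

(** Finitely many terms are discarded by a shift: with moving times and points, the dominating
    functions are valid only once these are close to their limits. *)
Lemma dominated_cvg_near : measurable D ->
  (\forall n \near \oo, measurable_fun D (f_ n)) ->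
  (forall x, D x -> f_ n x @[n --> \oo] --> f x) ->
  mu.-integrable D (EFin \o g) ->
  (\forall n \near \oo, forall x, D x -> `|f_ n x| <= (g x)%:E) ->
  \int[mu]_(x in D) f_ n x @[n --> \oo] --> \int[mu]_(x in D) f x.
Proof.
move=> mD [N1 _ mf] ff ig [N2 _ fg]; pose N := maxn N1 N2.
rewrite -(cvg_shiftn N).
apply: (@dominated_cvg _ _ R mu D mD (fun n => f_ (n + N)%N) f (EFin \o g)) => //.
- by move=> n; apply: mf => /=; rewrite (leq_trans (leq_maxl _ _) (leq_addl _ _)).
- by move=> x Dx; rewrite (cvg_shiftn N (fun n => f_ n x)); exact: ff.
- move=> n x Dx; apply: fg => //=.
  by rewrite (leq_trans (leq_maxr _ _) (leq_addl _ _)).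
Qed.

End dominated_convergence_near.

Section duhamel_limits.
Context {R : realType} {d : nat}.
Implicit Types (t s : R) (x y : 'rV[R]_d) (g : R -> 'rV[R]_d -> R).

Lemma heat_kernel_integrable t x : 0 < t ->
  (lebesgue_rV d).-integrable setT (fun y => (heat_kernel t (x - y))%:E).
Proof.
move=> t0; apply/integrableP; split; first exact: emeasurable_heat_kernel_sub.
under eq_integral do rewrite gee0_abs ?lee_fin ?heat_kernel_ge0//.
by rewrite integral_heat_kernel// ltry.
Qed.

Lemma cvg_heat_fun (r_ : R^nat) (x_ : nat -> 'rV[R]_d)
    (f_ : nat -> 'rV[R]_d -> R) (r : R) x (f : 'rV[R]_d -> R) (C : R) : 0 < r ->
  r_ n @[n --> \oo] --> r -> x_ n @[n --> \oo] --> x ->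
  (forall n, measurable_fun setT (f_ n)) ->
  (forall n y, 0 <= f_ n y <= C) ->
  (forall y, f_ n y @[n --> \oo] --> f y) ->
  heat_fun (r_ n) (f_ n) (x_ n) @[n --> \oo] --> heat_fun r f x.
Proof.
move=> r0 rr xx mf fC ff.
have [K K0 hK] := heat_kernel_dominated (d := d) r0.
have r_gt0 : \forall n \near \oo, 0 < r_ n by exact: cvgr_gt rr _ r0.
have C0 : 0 <= C by have /andP[] := fC 0%N 0; exact: le_trans.
apply: (@dominated_cvg_near _ _ R (lebesgue_rV d) setT _ _
  (fun y => C * K * heat_kernel (4 * r) (x - y))) => //.
- by near=> n; apply: measurable_heat_fun_integrand => //; near: n.
- move=> y _; apply: cvg_EFin; first exact: nearW.
  apply: cvgM; last exact: ff.
  by apply: cvg_heat_kernel => //; apply: cvgB => //; exact: cvg_cst.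
- have /integrableZl : (lebesgue_rV d).-integrable setT
      (fun y => (heat_kernel (4 * r) (x - y))%:E).
    by apply: heat_kernel_integrable; rewrite mulr_gt0.
  by move=> /(_ measurableT (C * K)).
- have e0 : enorm (x_ n - x) ^+ 2 @[n --> \oo] --> (0 : R).
    have -> : 0 = enorm (x - x) ^+ 2.
      by rewrite enorm_sqr big1// => i _; rewrite subrr mxE expr0n.
    by apply: cvg_enorm_sqr; apply: cvgB => //; exact: cvg_cst.
  near=> n => y _; have /andP[f0 f1] := fC n y.
  rewrite gee0_abs lee_fin; last by rewrite mulr_ge0 ?heat_kernel_ge0.
  rewrite mulrC -mulrA; apply: ler_pM; rewrite ?heat_kernel_ge0//.
  apply: hK; near: n.
  + by apply: cvgr_ge rr _ _; rewrite ltr_pdivrMr// ltr_pMr// ltr1n.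
  + by apply: cvgr_le rr _ _; rewrite ltr_pMl// ltr1n.
  + by apply: cvgr_le e0 _ _; rewrite ltr01.
Unshelve. all: by end_near. Qed.

(** Two bounds with different tasks: [B s], uniform in space and in n but possibly unbounded as s
    tends to 0, gives convergence of the heat integral at each s; [C], uniform in s, dominates the
    time integral. *)
Lemma cvg_duhamel (g_ : nat -> R -> 'rV[R]_d -> R) g (t_ : R^nat)
    (x_ : nat -> 'rV[R]_d) t x (B : R -> R) (C : R) : 0 < t -> 0 <= C ->
  (forall n, nonneg_measurable (g_ n)) ->
  (forall n s y, 0 < s -> g_ n s y <= B s) ->
  (forall s y, 0 < s -> g_ n s y @[n --> \oo] --> g s y) ->
  t_ n @[n --> \oo] --> t -> x_ n @[n --> \oo] --> x ->
  (forall n s, 0 < s < t_ n -> (heat_fun (t_ n - s) (g_ n s) (x_ n) <= C%:E)%E) ->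
  duhamel (g_ n) (t_ n) (x_ n) @[n --> \oo] --> duhamel g t x.
Proof.
move=> t0 C0 mg gB gg tt xx hC.
(* A common domain that contains the intervals ]0, t_n[ for large n, up to the null set {t}. The
   point t is removed because there the indicator of ]0, t_n[ need not converge. *)
pose D := `]0, t + 1[%classic `\ t.
have mD : measurable D by exact: measurableD.
pose F n := (fun s => heat_fun (t_ n - s) (g_ n s) (x_ n)) \_ `]0, t_ n[.
pose F0 := (fun s => heat_fun (t - s) (g s) x) \_ `]0, t[.
have mF n : measurable_fun setT (F n).
  apply/(measurable_restrictT _ (measurable_itv _)).
  exact: measurable_heat_fun_time.
have mg0 : nonneg_measurable g.
  split=> [|s y s0].
    apply: (@measurable_fun_cvg _ _ R _ (fun n p => g_ n p.1 p.2)).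
      by move=> n; have [] := mg n.
    by move=> [s y] s0; exact: gg.
  rewrite -(cvg_lim (@Rhausdorff R) (gg s y s0)); apply: limr_ge.
    by apply/cvg_ex; exists (g s y); exact: gg.
  by apply: nearW => n; have [_ ->] := mg n.
have mF0 : measurable_fun setT F0.
  apply/(measurable_restrictT _ (measurable_itv _)).
  exact: measurable_heat_fun_time.
have on_D (h : R -> \bar R) (r : R) : r <= t + 1 ->
    measurable_fun setT (h \_ `]0, r[) ->
    (\int[@lebesgue_measure R]_(s in `]0%R, r[) h s =
     \int[@lebesgue_measure R]_(s in D) (h \_ `]0%R, r[) s)%E.
  move=> rt mh.
  rewrite integral_setD1; [|exact: mD|exact: measurable_funTS].
  rewrite -integral_mkcondr setIidr//.
  by move=> s /=; rewrite !in_itv/= => /andP[-> /lt_le_trans]; exact.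
have tt1 : \forall n \near \oo, t_ n <= t + 1.
  by apply: cvgr_le tt _ _; rewrite ltrDl.
rewrite /duhamel on_D//; last by rewrite lerDl.
apply: cvg_trans (_ : \int[@lebesgue_measure R]_(s in D) F n s @[n --> \oo] --> _)%E.
  apply: near_eq_cvg; near=> n; rewrite on_D//; last exact: mF.
  by near: n; exact: tt1.
apply: (@dominated_cvg_near _ _ R (@lebesgue_measure R) D F F0 (cst C)) => //.
- by apply: nearW => n; exact: (measurable_funTS (mF n)).
- move=> s [/=]; rewrite in_itv/= => /andP[s0 _] /eqP st.
  rewrite /F0 patchE; case: ifPn; rewrite ?inE ?notin_setE/= in_itv/= s0/=.
    move=> s_t.
    apply: cvg_trans (_ : heat_fun (t_ n - s) (g_ n s) (x_ n) @[n --> \oo] --> _).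
      apply: near_eq_cvg; near=> n; rewrite /F patchE mem_set//= in_itv/= s0/=.
      by near: n; apply: cvgr_gt tt _ s_t.
    apply: (@cvg_heat_fun _ _ _ _ _ _ (B s)); rewrite ?subr_gt0//.
    + by apply: cvgB => //; exact: cvg_cst.
    + by move=> n; apply: (measurable_slice (f := fun p => g_ n p.1 p.2)); case: (mg n).
    + by move=> n y; have [_ ->] := mg n; rewrite // gB.
    + by move=> y; exact: gg.
  move=> /negP; rewrite -leNgt le_eqVlt eq_sym (negbTE st)/= => ts.
  apply: cvg_near_cst; near=> n.
  rewrite /F patchE memNset//= in_itv/= s0/=; apply/negP; rewrite -leNgt.
  by near: n; apply: cvgr_le tt _ ts.
- have mC : measurable_fun D (EFin \o cst C) by exact/measurable_EFinP.
  apply/integrableP; split=> //.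
  apply: (@le_lt_trans _ _ (C%:E * @lebesgue_measure R D)%E).
    apply: integral_le_bound => //.
    by apply/nearW => s _; rewrite gee0_abs.
  apply: lte_mul_pinfty => //.
  apply: (@le_lt_trans _ _ (@lebesgue_measure R `]0%R, t + 1[%classic)).
    by apply: le_measure; rewrite ?inE// => s [].
  by rewrite lebesgue_measure_itv/= lte_fin addr_gt0// ltry.
- near=> n => s [/=]; rewrite in_itv/= => /andP[s0 _] _.
  rewrite /F patchE; case: ifPn; rewrite ?inE ?notin_setE/= in_itv/= s0/=.
    move=> st; rewrite gee0_abs ?hC ?s0//.
    by apply: heat_fun_ge0 => y; have [_ ->] := mg n.
  by move=> _; rewrite normr0 lee_fin.
Unshelve. all: by end_near. Qed.

End duhamel_limits.

(** * A priori bound *)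

Section a_priori_bound.
Context {R : realType} {d : nat}.
Variable gamma : R.
Hypothesis g01 : 0 < gamma < 1.
Implicit Types (t s : R) (x y : 'rV[R]_d) (u v : R -> 'rV[R]_d -> R).

Let g0 : 0 < gamma. Proof. by have /andP[] := g01. Qed.

Lemma cvg_powR_iter (B : R) : 0 < B -> B `^ (gamma ^+ n) @[n --> \oo] --> (1 : R).
Proof.
move=> B0; have h : gamma ^+ n * ln B @[n --> \oo] --> 0 * ln B.
  apply: cvgM; last exact: cvg_cst.
  by apply: cvg_expr; rewrite ger0_norm ?ltW//; have /andP[] := g01.
rewrite mul0r in h; rewrite -[X in _ --> X](@expR0 R).
rewrite (_ : (fun n => _) = expR \o (fun n => gamma ^+ n * ln B)).
  exact: (cvg_comp _ (@expR R) h (@continuous_expR R _)).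
by apply/funext => n; rewrite /powR gt_eqF.
Qed.

Lemma cvg_pow_iter_le (B c r : R) : 0 < B ->
  (forall n, r <= B `^ (gamma ^+ n) * c) -> r <= c.
Proof.
move=> B0 h; have cv : B `^ (gamma ^+ n) * c @[n --> \oo] --> 1 * c.
  by apply: cvgM; [exact: cvg_powR_iter|exact: cvg_cst].
rewrite -[leRHS]mul1r -(cvg_lim (@Rhausdorff R) cv); apply: limr_ge.
  by apply/cvg_ex; exists (1 * c).
exact: nearW.
Qed.

(** By [heat_mild] the left side is the mild equation at (t, x) with its nonnegative time integral
    truncated at s. The bound does not degenerate as s tends to 0. *)
Lemma heat_fun_le_solution (mu : {finite_measure set 'rV[R]_d -> \bar R}) v t s x :
  nonneg_measurable v -> 0 < s < t ->
  (forall s y, 0 < s -> ((v s y)%:E =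
     heat_measure s mu y + duhamel (fun r z => v r z `^ gamma)%R s y)%E) ->
  (heat_fun (t - s) (v s) x <= (v t x)%:E)%E.
Proof.
move=> mv st vE; have /andP[s0 s_t] := st.
have mvg := nonneg_measurable_powR gamma mv.
rewrite (heat_mild x mvg st (fun y => vE s y s0)) vE ?(lt_trans s0)// leeD2l//.
apply: ge0_subset_integral => //.
- exact: measurable_heat_fun_time.
- by move=> r _; apply: heat_fun_ge0 => y; exact: powR_ge0.
- by move=> r /=; rewrite !in_itv/= => /andP[-> /lt_trans]; exact.
Qed.

Section bound_step.
Variables (mu : {finite_measure set 'rV[R]_d -> \bar R}).
Hypothesis mu0 : mu setT != 0%E.

Lemma fine_heat_measure_gt0 t x : 0 < t -> 0 < fine (heat_measure t mu x).
Proof.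
by move=> t0; rewrite fine_gt0// heat_measure_gt0//= heat_measure_lty.
Qed.

(** One turn of the iteration. Jensen turns the bound B Phi into B^gamma Phi^gamma, and the scalar
    equation integrates Phi^gamma back to Phi; [1 <= B] lets the initial value be multiplied by
    B^gamma. The case s < t feeds the next turn, the case s = t bounds the solution itself. *)
Lemma mild_bound_step u t s x (B : R) : nonneg_measurable u -> 1 <= B ->
  0 < s -> s <= t ->
  (forall r, 0 < r < s -> (heat_fun (t - r) (u r) x <=
     (B * ode_sol gamma r (fine (heat_measure t mu x)))%:E)%E) ->
  (heat_measure t mu x + \int[@lebesgue_measure R]_(r in `]0%R, s[)
     heat_fun (t - r) (fun y => u r y `^ gamma)%R x <=
   (B `^ gamma * ode_sol gamma s (fine (heat_measure t mu x)))%:E)%E.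
Proof.
move=> mu_ B1 s0 st hu; have t0 := lt_le_trans s0 st.
set a := fine _ in hu *.
have a0 : 0 < a by exact: fine_heat_measure_gt0.
have aE : heat_measure t mu x = a%:E by rewrite fineK// heat_measure_fin_num.
have B0 : 0 < B by exact: lt_le_trans B1.
have Bg1 : 1 <= B `^ gamma.
  by rewrite -[leLHS](@powRr0 R B); apply: ler_powR => //; exact: ltW.
have mug := nonneg_measurable_powR gamma mu_.
have mPhi : measurable_fun `]0%R, s[
    (fun r => (ode_sol gamma r a `^ gamma)%:E).
  by apply/measurable_EFinP/measurable_funTS; exact: measurable_ode_pow.
rewrite aE; apply: (@le_trans _ _ ((B `^ gamma)%:E * a%:E + (B `^ gamma)%:E *
  \int[@lebesgue_measure R]_(r in `]0%R, s[) (ode_sol gamma r a `^ gamma)%:E)%E).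
  apply: leeD; first by rewrite -EFinM lee_fin ler_peMl// ltW.
  rewrite -ge0_integralZl_EFin//; last 2 first.
  - by move=> r _; rewrite lee_fin powR_ge0.
  - exact: powR_ge0.
  apply: ge0_le_integral => //.
  - by move=> r _; apply: heat_fun_ge0 => y; exact: powR_ge0.
  - have := @measurable_funS _ _ _ _ `]0, t[%classic `]0, s[%classic _
      (measurable_itv _) _ (@measurable_heat_fun_time R d _ t x mug).
    by apply=> r /=; rewrite !in_itv/= => /andP[-> /lt_le_trans]; exact.
  - by apply: emeasurable_funM.
  move=> r /=; rewrite in_itv/= => r0s; have /andP[r0 rs] := r0s.
  have Phi0 : 0 < ode_sol gamma r a.
    exact: lt_le_trans a0 (le_ode_sol g01 (ltW r0) (ltW a0)).
  rewrite -EFinM -powRM ?(ltW B0) ?(ltW Phi0)//; apply: heat_fun_powR_le => //.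
  - by rewrite subr_gt0 (lt_le_trans rs).
  - by apply: (measurable_slice (f := fun p => u p.1 p.2)); case: mu_.
  - by move=> y; case: mu_ => _; exact.
  - by rewrite mulr_gt0.
  - exact: hu.
rewrite -ge0_muleDr; last 2 first.
- by rewrite lee_fin ltW.
- by apply: integral_ge0 => r _; rewrite lee_fin powR_ge0.
by rewrite (ode_sol_integral g01)// EFinM.
Qed.

Lemma mild_solution_le v t x : nonneg_measurable v -> 0 < t ->
  (forall s y, 0 < s -> ((v s y)%:E =
     heat_measure s mu y + duhamel (fun r z => v r z `^ gamma)%R s y)%E) ->
  v t x <= ode_sol gamma t (fine (heat_measure t mu x)).
Proof.
move=> mv t0 vE; have [_ v0] := mv; set a := fine _.
have a0 : 0 < a by exact: fine_heat_measure_gt0.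
have mvg := nonneg_measurable_powR gamma mv.
(* With this B, v(t, x) <= B a <= B Phi(s, a) for all s in ]0, t[, so [heat_fun_le_solution] starts
   the iteration; the entry 1 is for [mild_bound_step]. *)
pose B := Num.max 1 (v t x / a).
have B1 : 1 <= B by rewrite le_max lexx.
have Bn1 n : 1 <= B `^ (gamma ^+ n).
  by rewrite -[leLHS](@powRr0 R B); apply: ler_powR => //; rewrite exprn_ge0 ?ltW.
have step n s : 0 < s < t -> (heat_fun (t - s) (v s) x <=
    (B `^ (gamma ^+ n) * ode_sol gamma s a)%:E)%E.
  elim: n s => [|n IH] s st; have /andP[s0 s_t] := st.
    apply: le_trans (heat_fun_le_solution x mv st vE) _.
    rewrite lee_fin expr0 powRr1 ?(le_trans ler01)//.
    apply: (@le_trans _ _ (B * a)).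
      by rewrite -ler_pdivrMr// le_max lexx orbT.
    by rewrite ler_pM2l ?(lt_le_trans ltr01)// (le_ode_sol g01)// ltW.
  rewrite (heat_mild x mvg st (fun y => vE s y s0)) exprSr powRrM.
  apply: mild_bound_step => //; first exact: ltW.
  by move=> r /andP[r0 rs]; apply: IH; rewrite r0 (lt_trans rs).
apply: (@cvg_pow_iter_le B) => [|n]; first exact: lt_le_trans B1.
apply: (@le_trans _ _ (B `^ (gamma ^+ n.+1) * ode_sol gamma t a)).
  rewrite -lee_fin vE// exprSr powRrM; apply: mild_bound_step => //.
  by move=> r; exact: step.
rewrite ler_wpM2r ?ode_sol_ge0//; apply: ler_powR => //.
by rewrite exprSr ler_piMr ?exprn_ge0 ?ltW//; have /andP[] := g01.
Qed.

End bound_step.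
End a_priori_bound.

(** * Stability *)

Section duhamel_order.
Context {R : realType} {d : nat}.
Implicit Types (t s : R) (x y : 'rV[R]_d) (g : R -> 'rV[R]_d -> R).

Lemma duhamel_mono g1 g2 t x : nonneg_measurable g1 -> nonneg_measurable g2 ->
  (forall s y, 0 < s -> g1 s y <= g2 s y) ->
  (duhamel g1 t x <= duhamel g2 t x)%E.
Proof.
move=> mg1 mg2 g12; have [m1 p1] := mg1; have [m2 p2] := mg2.
apply: ge0_le_integral => //.
- move=> s /=; rewrite in_itv/= => /andP[s0 _].
  by apply: heat_fun_ge0 => y; exact: p1.
- exact: measurable_heat_fun_time.
- exact: measurable_heat_fun_time.
- move=> s /=; rewrite in_itv/= => /andP[s0 st]; apply: heat_fun_mono.
  + by rewrite subr_gt0.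
  + exact: measurable_slice m1 s0.
  + exact: measurable_slice m2 s0.
  + by move=> y; rewrite p1// g12.
Qed.

Lemma duhamel_lin g1 g2 t x (a b : R) :
  nonneg_measurable g1 -> nonneg_measurable g2 -> 0 <= a -> 0 <= b ->
  (duhamel (fun s y => a * g1 s y + b * g2 s y)%R t x =
   a%:E * duhamel g1 t x + b%:E * duhamel g2 t x)%E.
Proof.
move=> mg1 mg2 a0 b0; have [m1 p1] := mg1; have [m2 p2] := mg2.
have h0 g s : nonneg_measurable g -> `]0, t[%classic s ->
    (0 <= heat_fun (t - s) (g s) x)%E.
  move=> [_ p] /=; rewrite in_itv/= => /andP[s0 _].
  by apply: heat_fun_ge0 => y; exact: p.
have mh g := @measurable_heat_fun_time R d g t x.
rewrite /duhamel -!ge0_integralZl_EFin//; first last.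
- exact: mh.
- by move=> s; exact: h0.
- exact: mh.
- by move=> s; exact: h0.
rewrite -ge0_integralD//; first last.
- by apply: emeasurable_funM => //; exact: mh.
- by move=> s st; apply: mule_ge0; [rewrite lee_fin|exact: h0].
- by apply: emeasurable_funM => //; exact: mh.
- by move=> s st; apply: mule_ge0; [rewrite lee_fin|exact: h0].
apply: eq_integral => s; rewrite inE/= in_itv/= => /andP[s0 st].
rewrite heat_fun_lin ?subr_gt0//.
- exact: measurable_slice m1 s0.
- exact: measurable_slice m2 s0.
- by move=> y; exact: p1.
- by move=> y; exact: p2.
Qed.

Lemma duhamel0 t x : duhamel (fun=> fun=> 0) t x = 0%E.
Proof.
rewrite /duhamel integral0_eq// => s /=; rewrite in_itv/= => /andP[_ st].
by rewrite heat_fun_cst// subr_gt0.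
Qed.

End duhamel_order.

(** For 0 <= z <= x + y the ratio u = z/(x + y) is at most 1, hence u <= u^r; the ratios of z = x
    and z = y add up to 1. *)
Lemma powR_subadditive {R : realType} (r x y : R) : 0 < r <= 1 -> 0 <= x -> 0 <= y ->
  (x + y) `^ r <= x `^ r + y `^ r.
Proof.
move=> /andP[r0 r1] x0 y0; have := addr_ge0 x0 y0.
rewrite le_eqVlt => /predU1P[<-|s0].
  by rewrite powR0 ?lt0r_neq0// addr_ge0 ?powR_ge0.
have h z : 0 <= z -> z <= x + y -> z / (x + y) * (x + y) `^ r <= z `^ r.
  rewrite le_eqVlt => /predU1P[<- _|z0 zs]; first by rewrite !mul0r powR_ge0.
  have -> : z `^ r = (z / (x + y)) `^ r * (x + y) `^ r.
    by rewrite -powRM ?divfK ?lt0r_neq0// ltW// divr_gt0.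
  rewrite ler_wpM2r ?powR_ge0//; apply: ger1_powR => //.
  by rewrite divr_gt0//= ler_pdivrMr// mul1r.
have -> : (x + y) `^ r = x / (x + y) * (x + y) `^ r + y / (x + y) * (x + y) `^ r.
  by rewrite -mulrDl -mulrDl divff ?lt0r_neq0// mul1r.
by rewrite lerD// h// ?lerDl ?lerDr.
Qed.

Section stability.
Context {R : realType} {d : nat}.
Variable gamma : R.
Hypothesis g01 : 0 < gamma < 1.
Implicit Types (t s : R) (x y : 'rV[R]_d) (v : R -> 'rV[R]_d -> R).

Let g0 : 0 < gamma. Proof. by have /andP[] := g01. Qed.

(** The class in which uniqueness and stability are proved. For finite non-zero data the upper
    bound, the continuity and the weighted norm bounds follow from it: [mild_solution_le],
    [solution_continuous], [solution_Linfty_loc]. *)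
Definition positive_solution (mu : set 'rV[R]_d -> \bar R) v : Prop :=
  [/\ nonneg_measurable v,
      (forall s y, 0 < s -> ((v s y)%:E =
         heat_measure s mu y + duhamel (fun r z => v r z `^ gamma)%R s y)%E) &
      (forall s y, 0 < s -> ode_sol gamma s 0 <= v s y)].

(** Two sequences of data, so that uniqueness and both one-sided comparisons of a sequence with its
    limit are instances. *)
Variables al be : nat -> {finite_measure set 'rV[R]_d -> \bar R}.
Variables a b : nat -> R -> 'rV[R]_d -> R.
Hypothesis al0 : forall n, al n setT != 0%E.
Hypothesis be0 : forall n, be n setT != 0%E.
Hypothesis sol_a : forall n, positive_solution (al n) (a n).
Hypothesis sol_b : forall n, positive_solution (be n) (b n).
Variable M : R.
Hypothesis al_le : forall n, (al n setT <= M%:E)%E.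
Hypothesis be_le : forall n, (be n setT <= M%:E)%E.

Let Sa n t x := fine (heat_measure t (al n) x).
Let Sb n t x := fine (heat_measure t (be n) x).

Hypothesis heat_al_be : forall t x, 0 < t ->
  Sa n t x - Sb n t x @[n --> \oo] --> 0.

(** A bound at time t for all [a n] and [b n], uniform in space: the maximum of the kernel times the
    common mass bound, taken as initial value of the scalar equation. *)
Let A t := ode_sol gamma t ((2 * pi * t) `^ (- (d%:R / 2)) * M).

Let sol_le (mu : {finite_measure set 'rV[R]_d -> \bar R}) v t x : 0 < t ->
  mu setT != 0%E -> (mu setT <= M%:E)%E -> positive_solution mu v -> v t x <= A t.
Proof.
move=> t0 mu0 muM [mv vE _].
apply: le_trans (mild_solution_le g01 mu0 x mv t0 vE) _.
apply: (ode_sol_mono g01); [exact: ltW|by rewrite fine_ge0// heat_measure_ge0|].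
rewrite -lee_fin fineK ?heat_measure_fin_num//.
apply: le_trans (heat_measure_le mu x t0) _.
by rewrite EFinM lee_wpmul2l// lee_fin powR_ge0.
Qed.

Let excess (l : R) n s y := Num.max 0 (a n s y - l * b n s y).

Let excess_le l n s y : 0 < s -> 0 <= l -> excess l n s y <= a n s y.
Proof.
move=> s0 l0; have [[_ pa] _ _] := sol_a n; have [[_ pb] _ _] := sol_b n.
by rewrite ge_max pa//= gerBl mulr_ge0// pb.
Qed.

Let excess_meas l n : nonneg_measurable (excess l n).
Proof.
have [[ma _] _ _] := sol_a n; have [[mb _] _ _] := sol_b n.
split=> [|s y _]; last by rewrite le_max lexx.
apply: measurable_maxr => //; apply: measurable_funB => //.
exact: measurable_funM.
Qed.

Let excess_duhamel l t x : 0 < t -> 0 <= l ->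
  (forall s y, 0 < s -> excess l n s y @[n --> \oo] --> 0) ->
  fine (duhamel (fun s y => excess l n s y `^ gamma) t x) @[n --> \oo] --> 0.
Proof.
move=> t0 l0 el; apply: fine_cvg => /=; rewrite -[X in _ --> X]/(0%E) -(duhamel0 t x).
(* The bound uniform in s is Jensen's inequality applied to S_{t-s} a_n(s, .)(x) <= a_n(t, x) <= A
   t; adding 1 makes the point of tangency positive. *)
apply: (@cvg_duhamel R d (fun n s y => excess l n s y `^ gamma) _ (cst t) (cst x)
  t x (fun s => A s `^ gamma) ((A t + 1) `^ gamma)) => //.
- exact: powR_ge0.
- by move=> n; exact: nonneg_measurable_powR.
- move=> n s y s0; have [_ e0] := excess_meas l n.
  have h : excess l n s y <= A s.
    by apply: le_trans (excess_le n y s0 l0) _; exact: (@sol_le (al n)).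
  apply: ge0_ler_powR => //; [exact: ltW|exact: e0|].
  by rewrite nnegrE (le_trans _ h)// e0.
- move=> s y s0; apply: cvg_powR0 => //; last exact: el.
  by move=> n; have [_ ->] := excess_meas l n.
- exact: cvg_cst.
- exact: cvg_cst.
move=> n s /andP[s0 st]; have [mv vE _] := sol_a n; have [me pe] := excess_meas l n.
have ts0 : 0 < t - s by rewrite subr_gt0.
apply: heat_fun_powR_le => //.
- exact: measurable_slice me s0.
- by move=> y; exact: pe.
- by rewrite ltr_pwDr// ode_sol_ge0.
apply: (@le_trans _ _ (heat_fun (t - s) (a n s) x)).
  apply: heat_fun_mono => //.
  - exact: measurable_slice me s0.
  - by have [ma _] := mv; exact: measurable_slice ma s0.
  - by move=> y; rewrite pe// excess_le.
apply: le_trans (heat_fun_le_solution x mv _ vE) _; first by rewrite s0.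
rewrite lee_fin (le_trans (sol_le x t0 (al0 n) (al_le n) (sol_a n)))//.
by rewrite lerDl.
Qed.

(** From a <= l b + excess, subadditivity of the power gives a^gamma <= l^gamma b^gamma +
    excess^gamma. In the mild equations the heat terms then contribute at most Sa - Sb, as l^gamma
    >= 1, and what remains is the Duhamel term of excess^gamma. *)
Let excess_step l t x : 0 < t -> 1 <= l ->
  (forall s y, 0 < s -> excess l n s y @[n --> \oo] --> 0) ->
  excess (l `^ gamma) n t x @[n --> \oo] --> 0.
Proof.
move=> t0 l1 el; have l0 : 0 <= l := le_trans ler01 l1.
pose N n := fine (duhamel (fun s y => excess l n s y `^ gamma) t x).
have lg1 : 1 <= l `^ gamma.
  by rewrite -[leLHS](@powRr0 R l); apply: ler_powR => //; exact: ltW.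
apply: (@squeeze_cvgr _ _ _ _ (cst 0) (fun n => `|Sa n t x - Sb n t x| + N n)).
- apply: nearW => n; rewrite le_max lexx/= ge_max.
  have [ma aE _] := sol_a n; have [mb bE _] := sol_b n.
  have mag := nonneg_measurable_powR gamma ma.
  have mbg := nonneg_measurable_powR gamma mb.
  have meg := nonneg_measurable_powR gamma (excess_meas l n).
  have N0 : 0 <= N n by rewrite fine_ge0// duhamel_ge0.
  rewrite addr_ge0//=.
  have D1 : (duhamel (fun s y => a n s y `^ gamma)%R t x <=
      (l `^ gamma)%:E * duhamel (fun s y => b n s y `^ gamma)%R t x +
      1%:E * duhamel (fun s y => excess l n s y `^ gamma)%R t x)%E.
    rewrite -duhamel_lin ?powR_ge0//; apply: duhamel_mono => //.
      have [m1 _] := mbg; have [m2 _] := meg.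
      split=> [|s y s0]; last by rewrite addr_ge0 ?mulr_ge0 ?powR_ge0.
      by apply: measurable_funD => //; exact: measurable_funM.
    move=> s y s0; have [_ pa] := ma; have [_ pb] := mb.
    have [_ pe] := excess_meas l n.
    rewrite mul1r -powRM ?pb//.
    apply: le_trans (powR_subadditive _ _ _); rewrite ?g0 ?pe ?mulr_ge0 ?pb//=.
      apply: ge0_ler_powR; rewrite ?nnegrE ?pa ?addr_ge0 ?pe ?mulr_ge0 ?pb ?(ltW g0)//.
      by rewrite -lerBlDl le_max lexx orbT.
    by have /andP[_ /ltW] := g01.
  (* This excludes the value +oo for the Duhamel term of the excess, so that [fine] in [N] loses
     nothing. *)
  have D2 : (duhamel (fun s y => excess l n s y `^ gamma)%R t x <=
      duhamel (fun s y => a n s y `^ gamma)%R t x)%E.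
    apply: duhamel_mono => // s y s0; have [_ pe] := excess_meas l n.
    have [_ pa] := ma.
    by apply: ge0_ler_powR; rewrite ?nnegrE ?pe ?pa ?excess_le ?(ltW g0).
  have Sa_ge0 : 0 <= Sa n t x by rewrite fine_ge0// heat_measure_ge0.
  have Sb_ge0 : 0 <= Sb n t x by rewrite fine_ge0// heat_measure_ge0.
  have := aE t x t0; have := bE t x t0.
  have SaE : heat_measure t (al n) x = (Sa n t x)%:E.
    by rewrite fineK// heat_measure_fin_num.
  have SbE : heat_measure t (be n) x = (Sb n t x)%:E.
    by rewrite fineK// heat_measure_fin_num.
  rewrite SaE SbE; move: D1 D2 (duhamel_ge0 t x meg) (duhamel_ge0 t x mag)
    (duhamel_ge0 t x mbg); rewrite /N.
  case: (duhamel (fun s y => a n s y `^ gamma) t x) => [da| |]//.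
  case: (duhamel (fun s y => b n s y `^ gamma) t x) => [db| |]//.
  case: (duhamel (fun s y => excess l n s y `^ gamma) t x) => [de| |]//=.
  rewrite -!EFinM -!EFinD !lee_fin => D1 D2 de0 da0 db0 [->] [->].
  have := ler_norm (Sa n t x - Sb n t x).
  nra.
- exact: cvg_cst.
- rewrite -[X in _ --> X](addr0 0); apply: cvgD.
    by rewrite -(@normr0 _ R); apply: cvg_norm; exact: heat_al_be.
  exact: excess_duhamel.
Qed.

(** The map r |-> max(r, Phi(t, 0)) is 1-Lipschitz, so exchanging Sa for Sb costs |Sa - Sb|; the
    lower bound in [positive_solution] then puts the maximum below b. *)
Let excess_init t x : 0 < t ->
  excess (2 `^ (1 - gamma)^-1) n t x @[n --> \oo] --> 0.
Proof.
move=> t0; set l := 2 `^ _; have l0 : 0 <= l by exact: powR_ge0.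
apply: (@squeeze_cvgr _ _ _ _ (cst 0) (fun n => l * `|Sa n t x - Sb n t x|)).
- apply: nearW => n; rewrite le_max lexx/= ge_max mulr_ge0//=.
  have [ma aE _] := sol_a n; have [mb bE bh] := sol_b n.
  have mbg := nonneg_measurable_powR gamma mb.
  have Sa_ge0 : 0 <= Sa n t x by rewrite fine_ge0// heat_measure_ge0.
  have h1 : a n t x <= l * Num.max (Sa n t x) (ode_sol gamma t 0).
    apply: le_trans (mild_solution_le g01 (al0 n) x ma t0 aE) _.
    by apply: (ode_sol_le_max g01) => //; exact: ltW.
  have h2 : Num.max (Sb n t x) (ode_sol gamma t 0) <= b n t x.
    rewrite ge_max bh// andbT -lee_fin bE// fineK ?heat_measure_fin_num//.
    by rewrite leeDl// duhamel_ge0.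
  rewrite lerBlDr -mulrDr (le_trans h1)// ler_wpM2l//.
  apply: le_trans (lerD (lexx _) h2).
  have := ler_norm (Sa n t x - Sb n t x).
  rewrite ge_max => h; apply/andP; split.
    by rewrite -lerBlDr (le_trans _ h)// lerB// le_max lexx.
  by rewrite -[leLHS]add0r lerD// le_max lexx orbT.
- exact: cvg_cst.
- rewrite -[X in _ --> X](mulr0 l); apply: cvgM; first exact: cvg_cst.
  by rewrite -(@normr0 _ R); apply: cvg_norm; exact: heat_al_be.
Qed.

Lemma cvg_solution_excess t x : 0 < t ->
  Num.max 0 (a n t x - b n t x) @[n --> \oo] --> 0.
Proof.
move=> t0; set l0 : R := 2 `^ (1 - gamma)^-1.
have l01 : 1 <= l0.
  rewrite -[leLHS](@powRr0 R 2); apply: ler_powR; first by rewrite ler1n.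
  by rewrite invr_ge0 subr_ge0; have /andP[_ /ltW] := g01.
have lk1 k : 1 <= l0 `^ (gamma ^+ k).
  by rewrite -[leLHS](@powRr0 R l0); apply: ler_powR => //; rewrite exprn_ge0 ?ltW.
have ek k : forall s y, 0 < s -> excess (l0 `^ (gamma ^+ k)) n s y @[n --> \oo] --> 0.
  elim: k => [|k IH] s y s0.
    by rewrite expr0 powRr1 ?powR_ge0//; exact: excess_init.
  by rewrite exprSr powRrM; exact: excess_step.
apply/cvgr0Pnorm_lt => e e0.
have At0 : 0 < A t + 1 by rewrite ltr_pwDr// ode_sol_ge0.
(* Since a - b = (a - l b) + (l - 1) b and b <= A t, such a k makes the second term at most e / 2
   and leaves e / 2 for the excess, which is small for large n. *)
have : \forall k \near \oo, l0 `^ (gamma ^+ k) < 1 + e / 2 / (A t + 1).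
  apply: cvgr_lt (cvg_powR_iter g01 _) _ _; first exact: lt_le_trans l01.
  by rewrite ltrDl !divr_gt0.
move=> [k _ /(_ k (leqnn k)) /= hk].
have e20 : 0 < e / 2 by rewrite divr_gt0.
have /cvgr0Pnorm_lt/(_ _ e20) := ek k t x t0.
apply: filterS => n; have [_ b0] := (let: And3 m _ _ := sol_b n in m).
have bA := sol_le x t0 (be0 n) (be_le n) (sol_b n).
have bp := b0 t x t0.
rewrite !ger0_norm ?le_max ?lexx// /excess !gt_max => /andP[_ h].
rewrite e0/=.
have : (l0 `^ (gamma ^+ k) - 1) * b n t x <= e / 2.
  apply: (@le_trans _ _ (e / 2 / (A t + 1) * (A t + 1))).
    apply: ler_pM; rewrite ?subr_ge0 ?lk1//; first by rewrite lerBlDl ltW.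
    by rewrite (le_trans bA)// lerDl.
  by rewrite divfK// lt0r_neq0.
have := lk1 k; nra.
Qed.

End stability.

(** * Existence *)

Section existence.
Context {R : realType} {d : nat}.
Variable gamma : R.
Hypothesis g01 : 0 < gamma < 1.
Implicit Types (t s : R) (x y : 'rV[R]_d) (u v : R -> 'rV[R]_d -> R).

Let g0 : 0 < gamma. Proof. by have /andP[] := g01. Qed.

Lemma ode_sol_gt0 s a : 0 < s -> 0 <= a -> 0 < ode_sol gamma s a.
Proof.
move=> s0 a0; have /andP[_ g1] := g01.
by rewrite powR_gt0// ltr_wpDl ?powR_ge0// mulr_gt0// subr_gt0.
Qed.

Variable mu : {finite_measure set 'rV[R]_d -> \bar R}.
Hypothesis mu0 : mu setT != 0%E.

Let S t x := fine (heat_measure t mu x).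

Let S_ge0 t x : 0 <= S t x.
Proof. by rewrite fine_ge0// heat_measure_ge0. Qed.

Let SE t x : 0 < t -> heat_measure t mu x = (S t x)%:E.
Proof. by move=> t0; rewrite fineK// heat_measure_fin_num. Qed.

Lemma heat_measure_bounded t0 t x : 0 < t0 -> t0 <= t ->
  S t x <= (2 * pi * t0) `^ (- (d%:R / 2)) * fine (mu setT).
Proof.
move=> t00 tt; have t_gt0 := lt_le_trans t00 tt.
rewrite -lee_fin -SE// EFinM fineK ?fin_num_measure//.
apply: le_trans (heat_measure_le mu x t_gt0) _.
rewrite lee_wpmul2r// lee_fin !powRN lef_pV2 ?posrE ?powR_gt0 ?mulr_gt0 ?pi_gt0//.
apply: ge0_ler_powR; rewrite ?nnegrE ?divr_ge0 ?mulr_ge0 ?pi_ge0 ?(ltW t00) ?(ltW t_gt0)//.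
by rewrite ler_pM2l// mulr_gt0 ?pi_gt0.
Qed.

(** A bound on the time interval [a, b], uniform in space: the maximum of the kernel is largest at
    the earliest time, and the scalar solution at the latest. *)
Definition solution_ub (a b : R) : R :=
  ode_sol gamma b ((2 * pi * a) `^ (- (d%:R / 2)) * fine (mu setT)).

Lemma le_solution_ub (a b : R) t x : 0 < a -> a <= t -> t <= b ->
  ode_sol gamma t (S t x) <= solution_ub a b.
Proof.
move=> a0 ta tb; have t0 := lt_le_trans a0 ta.
apply: le_trans (_ : ode_sol gamma b (S t x) <= _).
  by apply: (ode_sol_mono_time g01); rewrite ?(ltW t0).
apply: (ode_sol_mono g01) => //; first exact: le_trans (ltW t0) tb.
exact: heat_measure_bounded.
Qed.

(** The value B = 1 is fixed by B |-> B^gamma, so the bound by the scalar solution is preserved by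
    the mild map. *)
Lemma mild_map_le u t x : 0 < t -> nonneg_measurable u ->
  (forall s, 0 < s < t -> (heat_fun (t - s) (u s) x <= (ode_sol gamma s (S t x))%:E)%E) ->
  (heat_measure t mu x + duhamel (fun r z => u r z `^ gamma)%R t x <=
   (ode_sol gamma t (S t x))%:E)%E.
Proof.
move=> t0 mu_ hu; rewrite -[X in (X%:E)%E](mul1r (ode_sol _ _ _)).
rewrite -[X in X * _](_ : 1 `^ gamma = 1); last by rewrite powR1.
by apply: mild_bound_step => // s st; rewrite mul1r; exact: hu.
Qed.

(** The starting point Phi(., 0) satisfies the equation without the heat term. The first step
    therefore increases it, and the monotone iterates never fall below the lower bound of the
    theorem. *)
Fixpoint mild_iter n s y : R :=
  if n is n'.+1 then
    fine (heat_measure s mu y + duhamel (fun r z => mild_iter n' r z `^ gamma)%R s y)%E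
  else ode_sol gamma s 0.

(** The bound is on S_{t-s} of the iterate because this is what Jensen consumes. Measurability and
    the bound are carried together: both are used to show that the next iterate is finite, hence
    solves its defining equation in the extended reals. *)
Lemma mild_iter_inv n : nonneg_measurable (mild_iter n) /\
  forall t x s, 0 < s < t ->
    (heat_fun (t - s) (mild_iter n s) x <= (ode_sol gamma s (S t x))%:E)%E.
Proof.
elim: n => [|n [mV hV]].
  split.
    split=> [|s y _]; last exact: ode_sol_ge0.
    apply: (measurableT_comp (f := fun s : R => ode_sol gamma s 0) (g := fst)).
      apply: measurableT_comp (@measurable_powR R _) _.
      by apply: measurable_funD => //; exact: measurable_funM.
    by apply: measurable_funTS.
  move=> t x s /andP[s0 st]; have ts0 : 0 < t - s by rewrite subr_gt0.
  rewrite (heat_fun_cst x ts0 (ode_sol_ge0 gamma s 0)).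
  by rewrite lee_fin; apply: (ode_sol_mono g01) => //; exact: ltW.
have mVg := nonneg_measurable_powR gamma mV.
have VE s y : 0 < s -> (mild_iter n.+1 s y)%:E =
    (heat_measure s mu y + duhamel (fun r z => mild_iter n r z `^ gamma)%R s y)%E.
  move=> s0; rewrite fineK// ge0_fin_numE; last first.
    by rewrite adde_ge0 ?heat_measure_ge0 ?duhamel_ge0.
  by apply: le_lt_trans (ltry _); apply: mild_map_le => // r; exact: hV.
split.
  split=> [|s y s0]; last by rewrite -lee_fin VE// adde_ge0 ?heat_measure_ge0 ?duhamel_ge0.
  apply: (measurableT_comp (f := fine) (g := fun p => (heat_measure p.1 mu p.2 +
    duhamel (fun r z => mild_iter n r z `^ gamma)%R p.1 p.2)%E)); first exact: fine_measurable.
  apply: emeasurable_funD; first exact: measurable_heat_measure.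
  exact: measurable_duhamel.
move=> t x s st; have /andP[s0 s_t] := st.
rewrite (heat_mild x mVg st (fun y => VE s y s0)).
rewrite -[X in (X%:E)%E](mul1r (ode_sol _ _ _)).
rewrite -[X in X * _](_ : 1 `^ gamma = 1); last by rewrite powR1.
apply: mild_bound_step => //; first exact: ltW.
by move=> r /andP[r0 rs]; rewrite mul1r; apply: hV; rewrite r0 (lt_trans rs).
Qed.

Lemma mild_iterS n s y : 0 < s -> (mild_iter n.+1 s y)%:E =
  (heat_measure s mu y + duhamel (fun r z => mild_iter n r z `^ gamma)%R s y)%E.
Proof.
move=> s0; have [mV hV] := mild_iter_inv n.
have mVg := nonneg_measurable_powR gamma mV.
rewrite fineK// ge0_fin_numE; last first.
  by rewrite adde_ge0 ?heat_measure_ge0 ?duhamel_ge0.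
by apply: le_lt_trans (ltry _); apply: mild_map_le => // r; exact: hV.
Qed.

(* The iterates are abstracted because the conversion test would unfold them. *)
Variable V : nat -> R -> 'rV[R]_d -> R.
Hypothesis V0 : V 0 = fun s _ => ode_sol gamma s 0.
Hypothesis mV : forall n, nonneg_measurable (V n).
Hypothesis hV : forall n t x s, 0 < s < t ->
  (heat_fun (t - s) (V n s) x <= (ode_sol gamma s (S t x))%:E)%E.
Hypothesis VS : forall n s y, 0 < s -> (V n.+1 s y)%:E =
  (heat_measure s mu y + duhamel (fun r z => V n r z `^ gamma)%R s y)%E.

Let mVg n : nonneg_measurable (fun s y => V n s y `^ gamma).
Proof. exact: nonneg_measurable_powR. Qed.

Let V_le n s y : 0 < s -> V n s y <= ode_sol gamma s (S s y).
Proof.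
move=> s0; case: n => [|n]; first by rewrite V0; apply: (ode_sol_mono g01) => //; exact: ltW.
rewrite -lee_fin (VS n y s0).
by apply: mild_map_le => // r; exact: hV.
Qed.

Let duhamel_V0 s y : 0 < s ->
  ((ode_sol gamma s 0)%:E <= duhamel (fun r z => V 0 r z `^ gamma)%R s y)%E.
Proof.
move=> s0; apply: le_trans (ode_sol0_integral g01 s0) _.
rewrite V0 le_eqVlt; apply/orP; left; apply/eqP; apply: eq_integral => r.
rewrite inE/= in_itv/= => /andP[_ rs]; have sr0 : 0 < s - r by rewrite subr_gt0.
by rewrite (heat_fun_cst y sr0 (powR_ge0 _ _)).
Qed.

Let V_nd n s y : 0 < s -> V n s y <= V n.+1 s y.
Proof.
elim: n s y => [|n IH] s y s0; rewrite -lee_fin.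
  rewrite (VS 0 y s0) {1}V0; apply: le_trans (duhamel_V0 y s0) _.
  by rewrite leeDr// heat_measure_ge0.
rewrite (VS n y s0) (VS n.+1 y s0); apply: leeD2l.
apply: (duhamel_mono _ _ (mVg n) (mVg n.+1)) => r z r0.
have [_ p1] := mV n; have [_ p2] := mV n.+1.
by apply: (ge0_ler_powR (ltW g0) (p1 r z r0) (p2 r z r0)); exact: IH.
Qed.

Let v s y : R := limn (fun n => V n s y).

Let V_homo s y : 0 < s -> {homo (fun n => V n s y) : n m / (n <= m)%N >-> n <= m}.
Proof. by move=> s0; apply/nondecreasing_seqP => n; exact: V_nd. Qed.

Let V_cvg s y : 0 < s -> V n s y @[n --> \oo] --> v s y.
Proof.
move=> s0; apply: nondecreasing_is_cvgn; first exact: V_homo.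
by exists (ode_sol gamma s (S s y)) => _ [n _ <-]; exact: V_le.
Qed.

Let V_le_v n s y : 0 < s -> V n s y <= v s y.
Proof.
move=> s0; apply: (nondecreasing_cvgn_le (V_homo y s0)).
by apply/cvg_ex; exists (v s y); exact: V_cvg.
Qed.

Let v_le s y : 0 < s -> v s y <= ode_sol gamma s (S s y).
Proof.
move=> s0; apply: limr_le; first by apply/cvg_ex; exists (v s y); exact: V_cvg.
by apply: nearW => n; exact: V_le.
Qed.

Let mv : nonneg_measurable v.
Proof.
split=> [|s y s0]; last first.
  by have [_ p] := mV 0; exact: le_trans (p s y s0) (V_le_v 0 y s0).
apply: (@measurable_fun_cvg _ _ R _ (fun n p => V n p.1 p.2)).
  by move=> n; have [] := mV n.
by move=> [s y] s0; exact: V_cvg.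
Qed.

Let v_gt0 s y : 0 < s -> 0 < v s y.
Proof. by move=> s0; apply: lt_le_trans (V_le_v 0 y s0); rewrite V0 ode_sol_gt0. Qed.

Lemma heat_powR_le u t s x : nonneg_measurable u -> 0 < s < t ->
  (heat_fun (t - s) (u s) x <= (ode_sol gamma s (S t x))%:E)%E ->
  (heat_fun (t - s) (fun y => u s y `^ gamma)%R x <=
   ((ode_sol gamma t (S t x)) `^ gamma)%:E)%E.
Proof.
move=> [mu_ u0] /andP[s0 st] h.
apply: (@le_trans _ _ ((ode_sol gamma s (S t x)) `^ gamma)%:E).
  apply: heat_fun_powR_le => //.
  - by rewrite subr_gt0.
  - exact: measurable_slice mu_ s0.
  - by move=> y; exact: u0.
  - exact: ode_sol_gt0.
rewrite lee_fin; apply: ge0_ler_powR; rewrite ?nnegrE ?ode_sol_ge0 ?(ltW g0)//.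
by apply: (ode_sol_mono_time g01); exact: ltW.
Qed.

Let vE s y : 0 < s ->
  (v s y)%:E = (heat_measure s mu y + duhamel (fun r z => v r z `^ gamma)%R s y)%E.
Proof.
move=> s0.
have c1 : (V n.+1 s y)%:E @[n --> \oo] --> (v s y)%:E.
  by apply: cvg_EFin; [exact: nearW|rewrite (cvg_shiftS (fun n => V n s y)); exact: V_cvg].
have c2 : (V n.+1 s y)%:E @[n --> \oo] -->
    (heat_measure s mu y + duhamel (fun r z => v r z `^ gamma)%R s y)%E.
  rewrite (_ : (fun n => _) = fun n => (heat_measure s mu y +
    duhamel (fun r z => V n r z `^ gamma)%R s y)%E); last first.
    by apply/funext => n; exact: VS.
  rewrite SE//; apply: cvgeD.
  - exact: fin_num_adde_defr.
  - exact: cvg_cst.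
  (* At each time r the iterates are bounded uniformly in space by [solution_ub r r]; the bound
     uniform in r comes from the invariant [hV] through [heat_powR_le]. *)
  apply: (@cvg_duhamel R d (fun n s y => V n s y `^ gamma) _ (cst s) (cst y) s y
    (fun r => solution_ub r r `^ gamma) (ode_sol gamma s (S s y) `^ gamma)) => //.
  - exact: powR_ge0.
  - move=> n r z r0; have [_ p] := mV n.
    have h : V n r z <= solution_ub r r.
      by apply: le_trans (V_le n z r0) _; exact: le_solution_ub.
    apply: ge0_ler_powR; rewrite ?nnegrE ?(ltW g0) ?p//.
    exact: le_trans (p _ _ r0) h.
  - by move=> r z r0; apply: cvg_powR; [exact: v_gt0|exact: V_cvg].
  - exact: cvg_cst.
  - exact: cvg_cst.
  - by move=> n r rs; apply: heat_powR_le => //; exact: hV.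
exact: cvg_unique c1 c2.
Qed.

(** The Duhamel term alone is at least Phi(s, 0), and strictness comes from the positive heat term,
    as mu is non-zero. *)
Let v_gt s y : 0 < s -> ode_sol gamma s 0 < v s y.
Proof.
move=> s0; rewrite -lte_fin vE//.
apply: (@le_lt_trans _ _ (duhamel (fun r z => v r z `^ gamma)%R s y)).
  apply: le_trans (duhamel_V0 y s0) _; apply: duhamel_mono => //.
    exact: nonneg_measurable_powR.
  move=> r z r0; have [_ p1] := mV 0; have [_ p2] := mv.
  by apply: ge0_ler_powR; rewrite ?nnegrE ?p1 ?p2 ?(ltW g0) ?V_le_v.
rewrite lteDr; first exact: heat_measure_gt0.
have := vE y s0; rewrite SE//.
by case: (duhamel _ _ _) => [r| |] //; rewrite addey.
Qed.

Lemma positive_solution_limit :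
  positive_solution gamma mu v /\ forall s y, 0 < s -> ode_sol gamma s 0 < v s y.
Proof.
split=> [|s y]; last exact: v_gt.
by split=> // s y s0; exact: ltW (v_gt y s0).
Qed.

End existence.

(** * Regularity *)

Lemma exists_positive_solution {R : realType} {d : nat} (gamma : R)
    (mu : {finite_measure set 'rV[R]_d -> \bar R}) :
  0 < gamma < 1 -> mu setT != 0%E -> exists v, positive_solution gamma mu v /\
    forall s y, 0 < s -> ode_sol gamma s 0 < v s y.
Proof.
move=> g01 mu0; eexists; apply: (@positive_solution_limit R d gamma g01 mu mu0
  (mild_iter gamma mu)) => //.
- by move=> n; have [] := mild_iter_inv g01 mu0 n.
- by move=> n t x s; have [_] := mild_iter_inv g01 mu0 n; exact.
- by move=> n s y s0; exact: mild_iterS.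
Qed.

(** Continuity is reduced to sequences, the form in which dominated convergence is available. They
    may be confined to a neighbourhood [P], later a band of times away from 0. *)
Lemma cvg_at_seq {R : realType} (T : pseudoMetricType R) (f : T -> R) (p : T)
    (P : set T) : nbhs p P ->
  (forall u : nat -> T, (forall n, P (u n)) -> u n @[n --> \oo] --> p ->
     f (u n) @[n --> \oo] --> f p) ->
  f x @[x --> p] --> f p.
Proof.
move=> Pp fu; apply/cvgrPdist_lt => e e0; apply: contrapT => H.
have /choice[u uP] n : exists x, [/\ P x, ball p n.+1%:R^-1 x & ~ `|f p - f x| < e].
  apply: contrapT => nx; apply: H.
  have rn : 0 < n.+1%:R^-1 :> R by rewrite invr_gt0.
  apply: filterS (filterI Pp (nbhsx_ballx p _ rn)) => x [Px bx].
  by apply: contrapT => h; apply: nx; exists x.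
have up : u n @[n --> \oo] --> p.
  apply/cvg_ballP => r r0; have := near_infty_natSinv_lt (PosNum r0).
  apply: filterS => n /ltW nr; have [_ b _] := uP n.
  exact: le_ball nr _ b.
have /cvgrPdist_lt/(_ _ e0) : f (u n) @[n --> \oo] --> f p.
  by apply: fu => // n; have [] := uP n.
by move=> [N _ /(_ N (leqnn N))/=]; have [_ _] := uP N.
Qed.

Section heat_measure_continuity.
Context {R : realType} {d : nat}.

Lemma cvg_heat_measure (mu : {finite_measure set 'rV[R]_d -> \bar R})
    (t_ : R^nat) (x_ : nat -> 'rV[R]_d) (t : R) (x : 'rV[R]_d) : 0 < t ->
  t_ n @[n --> \oo] --> t -> x_ n @[n --> \oo] --> x ->
  heat_measure (t_ n) mu (x_ n) @[n --> \oo] --> heat_measure t mu x.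
Proof.
move=> t0 tt xx.
pose C := (2 * pi * (t / 2)) `^ (- (d%:R / 2)) : R.
have t20 : 0 < t / 2 by rewrite divr_gt0.
have t_gt : \forall n \near \oo, t / 2 < t_ n.
  by apply: cvgr_gt tt _ _; rewrite ltr_pdivrMr// ltr_pMr// ltr1n.
apply: (@dominated_cvg_near _ _ R mu setT _ _ (cst C)) => //.
- near=> n; apply: emeasurable_heat_kernel_sub.
  by apply: lt_trans t20 _; near: n.
- move=> y _; apply: cvg_EFin; first exact: nearW.
  by apply: cvg_heat_kernel => //; apply: cvgB => //; exact: cvg_cst.
- exact: finite_measure_integrable_cst.
- near=> n => y _.
  have tn : t / 2 < t_ n by near: n.
  have tn0 := lt_trans t20 tn.
  rewrite gee0_abs lee_fin ?heat_kernel_ge0//.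
  apply: le_trans (heat_kernel_le _ tn0) _.
  rewrite /C !powRN lef_pV2 ?posrE ?powR_gt0 ?mulr_gt0 ?pi_gt0//.
  apply: ge0_ler_powR; rewrite ?nnegrE ?divr_ge0 ?mulr_ge0 ?pi_ge0 ?(ltW t0) ?(ltW tn0)//.
  by rewrite ler_pM2l ?(ltW tn)// mulr_gt0 ?pi_gt0.
Unshelve. all: by end_near. Qed.

End heat_measure_continuity.

Section regularity.
Context {R : realType} {d : nat}.
Variable gamma : R.
Hypothesis g01 : 0 < gamma < 1.
Variable mu : {finite_measure set 'rV[R]_d -> \bar R}.
Hypothesis mu0 : mu setT != 0%E.
Variable v : R -> 'rV[R]_d -> R.
Hypothesis sol_v : positive_solution gamma mu v.
Implicit Types (t s : R) (x y : 'rV[R]_d).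

Let mv : nonneg_measurable v. Proof. by have [] := sol_v. Qed.
Let vE s y : 0 < s -> ((v s y)%:E =
  heat_measure s mu y + duhamel (fun r z => v r z `^ gamma)%R s y)%E.
Proof. by have [_ + _] := sol_v; exact. Qed.

Let mvg : nonneg_measurable (fun s y => v s y `^ gamma).
Proof. exact: nonneg_measurable_powR. Qed.

Let v_le t x : 0 < t -> v t x <= ode_sol gamma t (fine (heat_measure t mu x)).
Proof. by move=> t0; exact: mild_solution_le. Qed.

Let v_bounded (a b : R) t x : 0 < a -> a <= t -> t <= b ->
  v t x <= solution_ub gamma mu a b.
Proof.
move=> a0 ta tb; apply: le_trans (v_le x (lt_le_trans a0 ta)) _.
exact: le_solution_ub.
Qed.

Lemma solution_continuous t x : 0 < t ->
  {for (t, x), continuous (fun p : R * 'rV[R]_d => v p.1 p.2)}.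
Proof.
move=> t0; pose P := [set p : R * 'rV[R]_d | t / 2 <= p.1 <= 2 * t].
have t20 : 0 < t / 2 by rewrite divr_gt0.
apply: (@cvg_at_seq R (R * 'rV[R]_d)%type (fun p => v p.1 p.2) (t, x) P).
  have h1 : nbhs t `[t / 2, 2 * t]%classic.
    have : \forall r \near t, r \in `]t / 2, 2 * t[.
      apply: near_in_itvoo.
      by rewrite in_itv/= ltr_pdivrMr// ltr_pMr ?ltr1n// ltr_pMl ?ltr1n.
    apply: filterS => r.
    by rewrite /= !in_itv/= => /andP[/ltW -> /ltW ->].
  exists (`[t / 2, 2 * t]%classic, setT) => /=; first by split=> //; exact: filterT.
  by move=> [r z] /= []; rewrite in_itv.
move=> u uP up.
have u1 : (u n).1 @[n --> \oo] --> t by exact: (cvg_comp _ _ up cvg_fst).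
have u2 : (u n).2 @[n --> \oo] --> x by exact: (cvg_comp _ _ up cvg_snd).
have un0 n : 0 < (u n).1 by have /andP[h _] := uP n; exact: lt_le_trans h.
rewrite (_ : (fun n => _) = fun n => fine (heat_measure (u n).1 mu (u n).2 +
    duhamel (fun r z => v r z `^ gamma)%R (u n).1 (u n).2)%E); last first.
  by apply/funext => n; rewrite -vE.
apply: fine_cvg; rewrite /= vE//; apply: cvgeD.
- by apply: fin_num_adde_defr; exact: heat_measure_fin_num.
- exact: cvg_heat_measure.
(* The constant is a bound for v^gamma on the band [t/2, 2t]: by [heat_fun_le_solution], S_{t_n - s}
   v(s, .)(x_n) is at most v(t_n, x_n), whose time lies in that band. *)
apply: (@cvg_duhamel R d (fun=> fun s y => v s y `^ gamma) _ _ _ t x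
  (fun s => solution_ub gamma mu s s `^ gamma)
  ((solution_ub gamma mu (t / 2) (2 * t)) `^ gamma)) => //.
- exact: powR_ge0.
- move=> _ s y s0; have [_ p] := mv.
  have /andP[/ltW g0 _] := g01.
  apply: ge0_ler_powR; rewrite ?nnegrE ?ode_sol_ge0 ?p//.
  exact: v_bounded.
- by move=> s y _; exact: cvg_cst.
move=> n s st; have /andP[s0 s_t] := st; have [m p] := mv.
apply: heat_fun_powR_le => //.
- by rewrite subr_gt0.
- exact: measurable_slice m s0.
- by move=> y; exact: p.
- apply: (ode_sol_gt0 g01); first by rewrite mulr_gt0.
  by rewrite mulr_ge0 ?powR_ge0// fine_ge0.
apply: le_trans (heat_fun_le_solution _ mv st vE) _.
by rewrite lee_fin; have /andP[? ?] := uP n; exact: v_bounded.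
Qed.

Lemma solution_nonneg_continuous : nonneg_continuous v.
Proof.
split; last by have [] := mv.
apply: continuous_in_subspaceT => -[t x]; rewrite inE => t0.
exact: solution_continuous.
Qed.

Section weighted_norm.
Variable w : 'rV[R]_d -> R.
Hypothesis mw : measurable_fun setT w.
Hypothesis w_int : (\int[lebesgue_rV d]_x `|w x|%:E < +oo)%E.

Let norm_le (a b : R) t : 0 < a -> a <= t -> t <= b ->
  (norm1w w (v t) <= (solution_ub gamma mu a b)%:E *
     \int[lebesgue_rV d]_x `|w x|%:E)%E.
Proof.
move=> a0 ta tb; have t0 := lt_le_trans a0 ta; have [m p] := mv.
have mvt : measurable_fun setT (v t) by exact: measurable_slice m t0.
rewrite -ge0_integralZl_EFin ?ode_sol_ge0//; last first.
  by apply/measurable_EFinP; exact: measurableT_comp.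
apply: ge0_le_integral => //.
- apply/measurable_EFinP; apply: measurableT_comp => //.
  exact: measurable_funM.
- apply: emeasurable_funM => //; apply/measurable_EFinP; exact: measurableT_comp.
- move=> y _; rewrite -EFinM lee_fin normrM mulrC ler_wpM2r//.
  by rewrite ger0_norm ?p//; exact: v_bounded.
Qed.

Let norm_lty (a b : R) t : 0 < a -> a <= t -> t <= b -> (norm1w w (v t) < +oo)%E.
Proof.
move=> a0 ta tb; apply: le_lt_trans (norm_le a0 ta tb) _.
by apply: lte_mul_pinfty => //; rewrite lee_fin ode_sol_ge0.
Qed.

Lemma solution_Linfty_loc : Linfty_loc_L1w w v.
Proof.
have [m p] := mv.
split=> [//|t t0|a b a0 ab].
  split; first exact: measurable_slice m t0.
    by apply: nearW => x; exact: p.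
  exact: norm_lty t0 (lexx t) (lexx t).
pose g (q : R * 'rV[R]_d) := `|w q.2 * v q.1 q.2|%:E.
have mg : measurable_fun (@space_time R d) g.
  apply/measurable_EFinP; apply: measurableT_comp => //.
  apply: measurable_funM => //; apply: measurable_funTS.
  exact: measurableT_comp mw measurable_snd.
have mN : measurable_fun `[a, b] (fun t : R => norm1w w (v t)).
  have := @measurable_fun_fubini_tonelli_F _ _ R 'rV[R]_d R (lebesgue_rV d)
    (g \_ (@space_time R d)).
  move=> /(_ _ _)/measurable_funTS => h.
  apply: (eq_measurable_fun (fubini_F (lebesgue_rV d) (g \_ (@space_time R d)))).
    move=> t; rewrite inE/= in_itv/= => /andP[at_ _].
    have t0 := lt_le_trans a0 at_.
    by apply: eq_integral => y _; rewrite patchE mem_set.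
  apply: h.
    by apply/(measurable_restrictT _ (measurable_space_time)).
  by move=> q; rewrite patchE; case: ifP => // _; rewrite lee_fin.
split=> //; rewrite unlock; case: ifP => // _.
apply: (@le_lt_trans _ _ ((solution_ub gamma mu a b)%:E *
     \int[lebesgue_rV d]_x `|w x|%:E)%E).
  apply/ess_supP; apply/nearW => t /=; rewrite patchE; case: ifP.
    rewrite inE/= in_itv/= => /andP[at_ tb].
    by rewrite gee0_abs ?norm_le// integral_ge0.
  by move=> _; rewrite abse0 mule_ge0 ?lee_fin ?ode_sol_ge0// integral_ge0.
by apply: lte_mul_pinfty => //; rewrite lee_fin ode_sol_ge0.
Qed.

End weighted_norm.
End regularity.

(** * Admissible solutions *)

Section weight.
Context {R : realType} {d : nat}.

Lemma measurable_weight (Cw : R) : measurable_fun [set: 'rV[R]_d] (weight Cw).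
Proof.
apply: measurable_funM => //; apply: measurableT_comp (@measurable_expR R) _.
apply: measurable_funN.
rewrite (_ : enorm = fun x : 'rV[R]_d => (\sum_(i < d) x ord0 i ^+ 2) `^ 2^-1).
  apply: measurableT_comp (@measurable_powR R _) _.
  by apply: measurable_sum => i; apply: measurable_funX; exact: measurable_rV_coord.
by apply/funext => x; rewrite powR12_sqrt// sumr_ge0// => i _; exact: sqr_ge0.
Qed.

(** The normalisation excludes a negative [Cw], for which the integral of the weight would be at
    most 0; otherwise the weight equals its modulus. *)
Lemma integral_norm_weight (Cw : R) :
  (\int[lebesgue_rV d]_x (weight Cw x)%:E = 1 ->
   \int[lebesgue_rV d]_x `|weight Cw x|%:E = 1)%E.
Proof.
have [Cw0 <-|Cw0 h] := leP 0 Cw.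
  apply: eq_integral => x _; rewrite ger0_norm// mulr_ge0//; exact: expR_ge0.
suff : (\int[lebesgue_rV d]_x (weight Cw x)%:E <= 0)%E by rewrite h lee_fin ler10.
have w0 (x : 'rV[R]_d) : (0 <= (- weight Cw x)%:E)%E.
  by rewrite lee_fin oppr_ge0 mulr_le0_ge0 ?expR_ge0// ltW.
rewrite (_ : (\int[_]_x _) = - \int[lebesgue_rV d]_x (- weight Cw x)%:E)%E.
  by rewrite oppe_le0 integral_ge0.
by rewrite -integral_ge0N//; apply: eq_integral => x _; rewrite -EFinN opprK.
Qed.

End weight.

Section admissible.
Context {R : realType} {d : nat}.
Variables gamma Cw : R.
Hypothesis g01 : 0 < gamma < 1.
Hypothesis intw : (\int[lebesgue_rV d]_x (weight Cw x)%:E = 1)%E.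

Lemma admissible_positive (mu : set 'rV[R]_d -> \bar R) v :
  admissible_solution gamma Cw mu v -> positive_solution gamma mu v.
Proof.
move=> [vE [mv _ _] [_ v0] bnd]; split=> // s y s0.
by rewrite (ode_sol0E g01); have [/ltW] := bnd s y s0.
Qed.

Lemma positive_admissible (mu : {finite_measure set 'rV[R]_d -> \bar R}) v :
  mu setT != 0%E -> positive_solution gamma mu v ->
  (forall s y, 0 < s -> ode_sol gamma s 0 < v s y) ->
  admissible_solution gamma Cw mu v.
Proof.
move=> mu0 sol_v hv; have [mv vE _] := sol_v; split.
- exact: vE.
- apply: (solution_Linfty_loc g01 mu0 sol_v); first exact: measurable_weight.
  by rewrite integral_norm_weight// ltry.
- exact: (solution_nonneg_continuous g01 mu0 sol_v).
move=> t x t0; split; first by rewrite -(ode_sol0E g01); exact: hv.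
have tS : heat_measure t mu x = (fine (heat_measure t mu x))%:E.
  by rewrite fineK// heat_measure_fin_num.
rewrite tS -EFinM -EFinD lee_fin.
apply: le_trans (mild_solution_le g01 mu0 x mv t0 vE) _.
by apply: (ode_sol_le_exp g01); [exact: ltW|rewrite fine_ge0// heat_measure_ge0].
Qed.

End admissible.

(** * Uniqueness and continuous dependence on the data *)

Lemma solution_unique {R : realType} {d : nat} (gamma : R)
    (mu : {finite_measure set 'rV[R]_d -> \bar R}) u v :
  0 < gamma < 1 -> mu setT != 0%E ->
  positive_solution gamma mu u -> positive_solution gamma mu v ->
  forall t x, 0 < t -> u t x = v t x.
Proof.
move=> g01 mu0 su sv t x t0.
suff le_uv a b : positive_solution gamma mu a -> positive_solution gamma mu b ->
    a t x <= b t x by apply/eqP; rewrite eq_le !le_uv.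
move=> sa sb.
(* Stability is applied to constant sequences with equal data: the positive part of a - b is a
   constant sequence tending to 0, hence is 0. *)
have : Num.max 0 (a t x - b t x) @[_ --> \oo] --> (0 : R).
  apply: (@cvg_solution_excess R d gamma g01 (fun=> mu) (fun=> mu) (fun=> a)
    (fun=> b) (fun=> mu0) (fun=> mu0) (fun=> sa) (fun=> sb) (fine (mu setT))) => //.
  - by move=> _; rewrite fineK// fin_num_measure.
  - by move=> _; rewrite fineK// fin_num_measure.
  - by move=> s y s0; rewrite subrr; exact: cvg_cst.
move=> /(cvg_lim (@Rhausdorff R)); rewrite lim_cst// => h.
by rewrite -subr_le0 -h le_max lexx orbT.
Qed.

Lemma weak_cvg_heat_measure {R : realType} {d : nat}
    (mu_ : nat -> {finite_measure set 'rV[R]_d -> \bar R})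
    (mu : {finite_measure set 'rV[R]_d -> \bar R}) (t : R) (x : 'rV[R]_d) :
  0 < t -> weak_cvg (fun n => mu_ n) mu ->
  heat_measure t (mu_ n) x @[n --> \oo] --> heat_measure t mu x.
Proof.
move=> t0 wc; apply: wc; first exact: continuous_heat_kernel_sub.
exists ((2 * pi * t) `^ (- (d%:R / 2))); split; first exact: num_real.
move=> M /ltW KM y _ /=; rewrite ger0_norm ?heat_kernel_ge0//.
exact: le_trans (heat_kernel_le _ t0) KM.
Qed.

(** Testing against the constant 1 shows that the masses converge, hence are bounded. *)
Lemma weak_cvg_mass_bounded {R : realType} {d : nat}
    (mu_ : nat -> {finite_measure set 'rV[R]_d -> \bar R})
    (mu : {finite_measure set 'rV[R]_d -> \bar R}) :
  weak_cvg (fun n => mu_ n) mu ->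
  exists M : R, (forall n, mu_ n setT <= M%:E)%E /\ (mu setT <= M%:E)%E.
Proof.
move=> wc.
have h : mu_ n setT @[n --> \oo] --> mu setT.
  have mE (nu : {finite_measure set 'rV[R]_d -> \bar R}) :
      nu setT = (\int[nu]_x (cst 1 x : R)%:E)%E.
    by rewrite -[LHS]mul1e -(integral_cst nu measurableT).
  rewrite mE (_ : (fun n => _) = fun n => (\int[mu_ n]_x (cst 1 x : R)%:E)%E).
    apply: wc; first exact: cst_continuous.
    by exists 1; split=> // M /ltW M1 y _ /=; rewrite normr1.
  by apply/funext => n; exact: mE.
have : cvgn (fun n => fine (mu_ n setT)).
  apply/cvg_ex; exists (fine (mu setT)); apply: fine_cvg.
  by rewrite fineK// fin_num_measure.
(* Boundedness holds for every number beyond some C; C + 1 is one of them. *)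
move=> /cvg_seq_bounded [C [_ /(_ (C + 1))]]; rewrite ltrDl ltr01 => /(_ isT) hM.
pose M := C + 1.
exists (Num.max M (fine (mu setT))); split=> [n|].
  rewrite -[mu_ n setT]fineK ?fin_num_measure// lee_fin le_max.
  by rewrite (le_trans (ler_norm _) (hM n I)).
by rewrite -[mu setT]fineK ?fin_num_measure// lee_fin le_max lexx orbT.
Qed.

Lemma solution_stable {R : realType} {d : nat} (gamma : R)
    (mu_ : nat -> {finite_measure set 'rV[R]_d -> \bar R})
    (mu : {finite_measure set 'rV[R]_d -> \bar R})
    (v_ : nat -> R -> 'rV[R]_d -> R) (v : R -> 'rV[R]_d -> R) :
  0 < gamma < 1 -> (forall n, mu_ n setT != 0%E) -> mu setT != 0%E ->
  (forall n, positive_solution gamma (mu_ n) (v_ n)) ->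
  positive_solution gamma mu v -> weak_cvg (fun n => mu_ n) mu ->
  forall t x, 0 < t -> v_ n t x @[n --> \oo] --> v t x.
Proof.
move=> g01 mun0 mu0 sn sv wc t x t0.
have [M [Mn M0]] := weak_cvg_mass_bounded wc.
have heat s y : 0 < s -> fine (heat_measure s (mu_ n) y) @[n --> \oo] -->
    fine (heat_measure s mu y).
  move=> s0; apply: fine_cvg; rewrite fineK ?heat_measure_fin_num//.
  exact: weak_cvg_heat_measure.
have e1 : Num.max 0 (v_ n t x - v t x) @[n --> \oo] --> (0 : R).
  apply: (cvg_solution_excess g01 mun0 (fun=> mu0) sn (fun=> sv) Mn (fun=> M0)) => //.
  move=> s y s0; rewrite -(subrr (fine (heat_measure s mu y))).
  by apply: cvgB; [exact: heat|exact: cvg_cst].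
have e2 : Num.max 0 (v t x - v_ n t x) @[n --> \oo] --> (0 : R).
  apply: (cvg_solution_excess g01 (fun=> mu0) mun0 (fun=> sv) sn (fun=> M0) Mn) => //.
  move=> s y s0; rewrite -(subrr (fine (heat_measure s mu y))).
  by apply: cvgB; [exact: cvg_cst|exact: heat].
(* A real number is the difference of its positive and negative parts, and the two one-sided
   comparisons send both parts of v_n - v to 0. *)
rewrite (_ : (fun n => _) = fun n =>
    v t x + (Num.max 0 (v_ n t x - v t x) - Num.max 0 (v t x - v_ n t x))).
  rewrite -[X in _ --> X]addr0 -[X in _ --> _ + X](subrr 0).
  by apply: cvgD; [exact: cvg_cst|exact: cvgB].
apply/funext => n; rewrite /Num.max subr_gt0 subr_gt0.
by case: ltgtP => h; lra.
Qed.

Theorem theorem2p2 (R : realType) (d : nat) (gamma Cw : R) :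
  (1 <= d)%N -> 0 < gamma < 1 ->
  (\int[lebesgue_rV d]_x (weight Cw x)%:E = 1)%E ->
  (forall mu : {finite_measure set 'rV[R]_d -> \bar R}, mu setT != 0%E ->
    exists v : R -> 'rV[R]_d -> R,
      admissible_solution gamma Cw mu v /\
      forall u : R -> 'rV[R]_d -> R, admissible_solution gamma Cw mu u ->
        forall t x, 0 < t -> u t x = v t x) /\
  (forall (mu_ : nat -> {finite_measure set 'rV[R]_d -> \bar R})
      (mu : {finite_measure set 'rV[R]_d -> \bar R})
      (v_ : nat -> R -> 'rV[R]_d -> R) (v : R -> 'rV[R]_d -> R),
    (forall n, mu_ n setT != 0%E) -> mu setT != 0%E ->
    (forall n, admissible_solution gamma Cw (mu_ n) (v_ n)) ->
    admissible_solution gamma Cw mu v ->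
    weak_cvg (fun n => mu_ n) mu ->
    forall t x, 0 < t -> v_ n t x @[n --> \oo] --> v t x).
Proof.
move=> _ g01 intw; split=> [mu mu0|mu_ mu v_ v mun0 mu0 sn sv wc].
  have [v [sv hv]] := exists_positive_solution g01 mu0.
  exists v; split; first exact: positive_admissible.
  by move=> u /(admissible_positive g01) su; exact: (solution_unique g01 mu0).
apply: (solution_stable g01 mun0 mu0 _ (admissible_positive g01 sv) wc).
by move=> n; exact: (admissible_positive g01 (sn n)).
Qed.
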